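(* Let $S$ be a positive trace-class contraction on a separable Hilbert space and put $m:=\operatorname{Tr}S$, $\mathcal D:=\operatorname{Tr}(S-S^2)$. For $0<\epsilon<1/2$ define $$Q_\epsilon:=\operatorname{rank}\mathbf 1_{(\epsilon,\infty)}(S),\qquad H_\epsilon:=\operatorname{rank}\mathbf 1_{[1-\epsilon,1]}(S),$$ $$L_\epsilon:=\left\lceil\left(m-\frac{\mathcal D}{\epsilon}\right)_+\right\rceil,\qquad L_\epsilon^\circ:=\max\left\{0,\left\lfloor m-\frac{\mathcal D}{\epsilon}\right\rfloor+1\right\},$$ where $x_+:=\max\{x,0\}$. Then $$H_\epsilon\ge L_\epsilon,\qquad\Lambda_\epsilon(S)=Q_\epsilon-H_\epsilon.$$ Consequently, every integer upper bound $Q_\epsilon\le\overline Q_\epsilon$ yields $$\Lambda_\epsilon(S)\le\overline Q_\epsilon-L_\epsilon,$$ and, more sharply, $$\Lambda_\epsilon(S)\le\max\{0,\overline Q_\epsilon-L_\epsilon^\circ\}\le\overline Q_\epsilon-L_\epsilon.$$ If $S=K^*K$ with $K$ Hilbert--Schmidt, $N\in\mathbb N_0$, $K_N$ has rank at most $N$ and $K-K_N$ is Hilbert--Schmidt, then with $W:=(I-KK^* )^{1/2}$, $e_N^2:=\|K-K_N\|_{\mathcal S_2}^2$ and $d_N^2:=\|W(K-K_N)\|_{\mathcal S_2}^2$, $$\Lambda_\epsilon(S)\le\min\left\{N+\kappa\!\left(\frac{d_N^2}{\epsilon(1-\epsilon)}\right),\ \max\left\{0,\ N+\kappa\!\left(\frac{e_N^2}{\epsilon}\right)-L_\epsilon^\circ\right\}\right\}.$$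 In particular (zero approximant), $$\Lambda_\epsilon(S)\le\min\left\{\kappa\!\left(\frac{\mathcal D}{\epsilon(1-\epsilon)}\right),\ \max\left\{0,\ \kappa\!\left(\frac m\epsilon\right)-L_\epsilon^\circ\right\}\right\}.$$ The outer maxima cannot in general be omitted: if $\Lambda_\epsilon(S)>0$ then $H_\epsilon\ge L_\epsilon^\circ$, but $L_\epsilon^\circ$ is not an unconditional lower bound for $H_\epsilon$ (there are positive trace-class contractions $S$ and $\epsilon$ with $H_\epsilon<L_\epsilon^\circ$).
   Context: For a positive contraction $S$, $\Lambda_\epsilon(S):=\operatorname{rank}\mathbf 1_{(\epsilon,1-\epsilon)}(S)$ (spectral projection for the open interval). $\|\cdot\|_{\mathcal S_2}$ is the Hilbert--Schmidt norm. For $r\ge0$, $\kappa(r):=\max\{0,\lceil r\rceil-1\}$. *)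

(* Defs.v *)
From HB Require Import structures.
From mathcomp Require Import all_boot all_order all_algebra.
From mathcomp Require Import sesquilinear.
From mathcomp Require Import complex.
From mathcomp Require Import all_classical all_reals all_analysis.

Set Implicit Arguments.
Unset Strict Implicit.
Unset Printing Implicit Defensive.

Import Order.TTheory GRing.Theory Num.Theory.
Import numFieldNormedType.Exports.

Local Open Scope classical_set_scope.
Local Open Scope ring_scope.
Local Open Scope complex_scope.

(* Complex Hilbert spaces; the inner product is linear in its first argument. *)
Record hilbert (R : realType) := Hilbert {
  carrier :> completeNormedModType R[i] ;
  inner : {dot carrier for Num.conj} ;
  inner_norm : forall x : carrier, inner x x = `|x| ^+ 2 }.

Arguments inner {R h}.

Definition separable (T : topologicalType) : Prop :=
  exists D : set T, countable D /\ dense D.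

Section Operators.
Variable R : realType.
Implicit Types H G : hilbert R.

(* On a complex space this entails self-adjointness: in R[i], 0 <= z says that
   z is real and nonnegative. *)
Definition positive_op H (T : H -> H) : Prop := forall x, 0 <= inner (T x) x.

Definition contraction H G (T : H -> G) : Prop := forall x, `|T x| <= `|x|.

Definition adjoint H G (T : H -> G) : G -> H :=
  get [set T' : G -> H | forall x y, inner (T x) y = inner x (T' y)].

(* The positive square root of a positive bounded T. *)
Definition sqrt_op H (T : H -> H) : H -> H :=
  get [set W : H -> H | [/\ linear W, continuous W, positive_op W &
                            forall x, W (W x) = T x]].

(* The dimension of the range, infinite dimensions being all sent to +oo. *)
Definition rank H G (T : H -> G) : \bar R :=
  ereal_sup [set n%:R%:E | n in [set n : nat |
    exists x : 'I_n -> H, forall c : 'I_n -> R[i],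
      \sum_(i < n) c i *: T (x i) = 0 -> forall i, c i = 0]].

(* Totality is expressed as maximality: no nonzero vector is orthogonal to B. *)
Definition orthonormal_basis H (B : set H) : Prop :=
  [/\ forall e, B e -> inner e e = 1,
      forall e f, B e -> B f -> e != f -> inner e f = 0 &
      forall x, (forall e, B e -> inner x e = 0) -> x = 0].

Definition hilbert_basis H : set H := get (@orthonormal_basis H).

(* Only meant for positive T: then T is trace class iff this is finite. *)
Definition trace H (T : H -> H) : \bar R :=
  \esum_(e in @hilbert_basis H) (complex.Re (inner (T e) e))%:E.

Definition hs_norm H G (T : H -> G) : \bar R :=
  sqrte (\esum_(e in @hilbert_basis H) (complex.Re `|T e| ^+ 2)%:E).

Definition hilbert_schmidt H G (T : H -> G) : Prop :=
  [/\ linear T, continuous T & (hs_norm T < +oo)%E].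

(* E is the projection-valued Borel measure on the real line such that S is the
   integral of t dE(t): countable additivity and the integral are expressed
   through the scalar measures A |-> <E(A) x, x>, and self-adjointness together
   with spectral_setI at A = B makes each E(A) an orthogonal projection.
   The values of E on non-Borel sets are irrelevant. *)
Record is_spectral_measure H (S : H -> H) (E : set R -> H -> H) : Prop := {
  spectral_linear : forall A : set (measurableTypeR R), measurable A -> linear (E A) ;
  spectral_selfadjoint : forall A : set (measurableTypeR R), measurable A ->
    forall x y, inner (E A x) y = inner x (E A y) ;
  spectral_setT : forall x, E setT x = x ;
  spectral_setI : forall A B : set (measurableTypeR R),
    measurable A -> measurable B -> forall x, E (A `&` B) x = E A (E B x) ;
  spectral_integral : forall x,
    exists mu : {measure set (measurableTypeR R) -> \bar R},
    [/\ forall A : set (measurableTypeR R), measurable A ->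
          mu A = (complex.Re (inner (E A x) x))%:E,
        mu.-integrable setT (fun t => t%:E) &
        inner (S x) x = (Rintegral mu setT (fun t => t))%:C] }.

(* spectral_measure S A is the spectral projection of S on A. *)
Definition spectral_measure H (S : H -> H) : set R -> H -> H :=
  get (@is_spectral_measure H S).

Definition spectral_rank H (S : H -> H) (A : set R) : \bar R :=
  rank (spectral_measure S A).

(* For linear S; continuity then follows from contraction. *)
Definition pos_tc_contraction H (S : H -> H) : Prop :=
  [/\ positive_op S, contraction S & (trace S < +oo)%E].

Definition trace_val H (S : H -> H) : R := fine (trace S).

Definition defect H (S : H -> H) : R := fine (trace (S \- (S \o S))).

Definition Lambda H (eps : R) (S : H -> H) := spectral_rank S `]eps, 1 - eps[.
Definition Qrank H (eps : R) (S : H -> H) := spectral_rank S `]eps, +oo[.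
Definition Hrank H (eps : R) (S : H -> H) := spectral_rank S `[1 - eps, 1].

Definition Llow H (eps : R) (S : H -> H) : int :=
  Num.ceil (Num.max (trace_val S - defect S / eps) 0).

Definition Lcirc H (eps : R) (S : H -> H) : int :=
  Num.max 0 (Num.floor (trace_val S - defect S / eps) + 1).

Definition kappa (r : R) : int := Num.max 0 (Num.ceil r - 1).

End Operators.

(* Main.v *)
Require Import Defs.
From HB Require Import structures.
From mathcomp Require Import all_boot all_order all_algebra.
From mathcomp Require Import sesquilinear.
From mathcomp Require Import complex.
From mathcomp Require Import all_classical all_reals all_analysis.
From mathcomp Require Import spectral finmap measurable_realfun ring lra.
Import Order.TTheory GRing.Theory Num.Theory.
Import numFieldNormedType.Exports.
Local Open Scope classical_set_scope.
Local Open Scope ring_scope.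
Set Implicit Arguments.
Unset Strict Implicit.
Unset Printing Implicit Defensive.
Local Open Scope complex_scope.

(** A positive trace class S has an orthonormal eigenbasis, and any spectral
measure of S acts on an eigenvector of eigenvalue t as the indicator of its
argument at t; the ranks in the theorem thus count eigenvalues in intervals.
Summing t - t(1-t)/eps <= 1_[1-eps,1](t) over the eigenvalues gives
m - D/eps <= H, strictly as soon as some eigenvalue lies in (eps, 1-eps).
Without such an eigenvalue strictness fails already for S = 0.

For the approximants, a span of eigenvectors of dimension k meets the kernel of
K_N in dimension at least k - N. There K - K_N coincides with K, and
|Kv|^2 = <Sv,v> while |WKv|^2 = <(S - S^2)v,v>, so each unit vector of that
intersection contributes more than eps, resp. eps(1-eps), to e_N^2, resp. d_N^2.

Eigenvectors come from the power method: for a positive T of norm 1,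
<T^n x, T^m x> = <T^(n+m) x, x> is nonincreasing in n + m, so T^n x converges
to a fixed point of T, and the trace prevents all these limits from vanishing. *)

(** * Inner products *)

(** [adjoint], [sqrt_op], [hilbert_basis] and [spectral_measure] are choices by [get], so nothing is
    known of them before an object with the required property is exhibited. Bases come from Zorn's
    lemma, operators from coordinates in a basis through Riesz-Fischer. No uniqueness of the
    spectral measure is proved: existence makes the chosen one satisfy its axioms, and the axioms
    alone fix its action on eigenvectors. Separability enters through existence, where the scalar
    measures are countable sums of point masses.

    [trace] and [hs_norm] are sums over the chosen basis, not over eigenvectors; Parseval and an
    exchange of nonnegative sums move them to the basis at hand.

    Ceilings and floors encode strictness: for integers, n < r gives n <= ceil r - 1, and x < h
    gives floor x + 1 <= h. The estimates behind [kappa] and [Lcirc] are therefore proved strict for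
    nonempty families, and the maxima with 0 take care of empty ones. *)

Section Basics.
Variables (R : realType) (H : hilbert R).
Implicit Types (x y z : H) (c : R[i]).

(** Squares are taken in [R] because the norms live in [R[i]]; estimates on them are within reach of
    [lra] and [nra]. *)
Definition sqc c : R := complex.Re c ^+ 2 + complex.Im c ^+ 2.
Definition sqn x : R := complex.Re (inner x x).

Lemma innerC x y : inner x y = (inner y x)^*%C.
Proof. by rewrite hermC expr0 mul1r. Qed.

Lemma innerDl x y z : inner (x + y) z = inner x z + inner y z.
Proof. exact: linearDl. Qed.

Lemma innerDr x y z : inner z (x + y) = inner z x + inner z y.
Proof. exact: linearDr. Qed.

Lemma innerBl x y z : inner (x - y) z = inner x z - inner y z.
Proof. exact: linearBl. Qed.

Lemma innerBr x y z : inner z (x - y) = inner z x - inner z y.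
Proof. exact: linearBr. Qed.

Lemma innerZl c x y : inner (c *: x) y = c * inner x y.
Proof. exact: linearZl_LR. Qed.

Lemma innerZr c x y : inner x (c *: y) = c^*%C * inner x y.
Proof. exact: linearZr_LR. Qed.

Lemma inner0l x : inner 0 x = 0. Proof. exact: linear0l. Qed.
Lemma inner0r x : inner x 0 = 0. Proof. exact: linear0r. Qed.

Lemma inner_suml I (r : seq I) (P : pred I) (F : I -> H) y :
  inner (\sum_(i <- r | P i) F i) y = \sum_(i <- r | P i) inner (F i) y.
Proof. exact: linear_sumlz. Qed.

Lemma inner_sumr I (r : seq I) (P : pred I) (F : I -> H) y :
  inner y (\sum_(i <- r | P i) F i) = \sum_(i <- r | P i) inner y (F i).
Proof. exact: linear_sumr. Qed.

Lemma sqnE x : inner x x = (sqn x)%:C.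
Proof.
have /ger0_Im := @dnorm_ge0 _ _ inner x; rewrite /sqn.
by case: (inner x x) => a b /= ->.
Qed.

Lemma sqn_ge0 x : 0 <= sqn x.
Proof. by rewrite -ler0c -sqnE; exact: dnorm_ge0. Qed.

Lemma sqn_eq0 x : (sqn x == 0) = (x == 0).
Proof.
by rewrite -(dnorm_eq0 inner) sqnE eq_complex /= eqxx andbT.
Qed.

Lemma sqn0 : sqn 0 = 0. Proof. by rewrite /sqn inner0l. Qed.

Lemma sqcE c : (sqc c)%:C = c * c^*%C.
Proof.
by case: c => a b; rewrite /sqc; apply/eqP; rewrite eq_complex /=;
   apply/andP; split; apply/eqP; ring.
Qed.

Lemma sqc_ge0 c : 0 <= sqc c.
Proof. by rewrite addr_ge0 ?sqr_ge0. Qed.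

Lemma sqc_eq0 c : (sqc c == 0) = (c == 0).
Proof.
rewrite paddr_eq0 ?sqr_ge0// !sqrf_eq0; case: c => a b /=.
by rewrite eq_complex.
Qed.

Lemma sqc0 : sqc 0 = 0. Proof. by apply/eqP; rewrite sqc_eq0. Qed.

Lemma sqcC c : sqc c^*%C = sqc c.
Proof. by case: c => a b; rewrite /sqc /= sqrrN. Qed.

Lemma sqcM c d : sqc (c * d) = sqc c * sqc d.
Proof. by case: c => a b; case: d => e f; rewrite /sqc /=; ring. Qed.

Lemma sqc_real (a : R) : sqc a%:C = a ^+ 2.
Proof. by rewrite /sqc /= expr0n addr0. Qed.

Lemma conjc_realM (a : R) c : (a%:C * c)^*%C = a%:C * c^*%C.
Proof.
case: c => u v; apply/eqP; rewrite eq_complex /=.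
by apply/andP; split; apply/eqP; ring.
Qed.

Lemma sqc_inner x y : sqc (inner x y) = sqc (inner y x).
Proof. by rewrite innerC sqcC. Qed.

Lemma sqnZ c x : sqn (c *: x) = sqc c * sqn x.
Proof.
apply: (@complexI R); rewrite -sqnE innerZl innerZr sqnE mulrA -sqcE.
by rewrite rmorphM.
Qed.

Lemma sqnN x : sqn (- x) = sqn x.
Proof. by rewrite /sqn (hnormN inner). Qed.

Lemma sqn_sub x y : sqn (x - y) = sqn x + sqn y - 2 * complex.Re (inner x y).
Proof.
rewrite /sqn innerBl !innerBr (innerC y x).
case: (inner x x) => ? ?; case: (inner y y) => ? ?; case: (inner x y) => ? ? /=.
ring.
Qed.

Lemma sqn_add x y : sqn (x + y) = sqn x + sqn y + 2 * complex.Re (inner x y).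
Proof.
rewrite /sqn innerDl !innerDr (innerC y x).
case: (inner x x) => ? ?; case: (inner y y) => ? ?; case: (inner x y) => ? ? /=.
ring.
Qed.

Lemma sqn_norm x : `|x| = (Num.sqrt (sqn x))%:C.
Proof.
have h : `|x| ^+ 2 = ((Num.sqrt (sqn x))%:C) ^+ 2 :> R[i].
  by rewrite -inner_norm -rmorphXn /= sqr_sqrtr ?sqn_ge0// -sqnE.
apply/eqP; rewrite -(@eqrXn2 _ 2)// ?h ?eqxx//.
by rewrite ler0c sqrtr_ge0.
Qed.

Lemma Re_norm x : complex.Re `|x| ^+ 2 = sqn x.
Proof. by rewrite sqn_norm /= sqr_sqrtr// sqn_ge0. Qed.

Lemma norm_lt x (e : R) : 0 < e -> (`|x| < e%:C) = (sqn x < e ^+ 2).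
Proof.
move=> e0; rewrite sqn_norm ltcR -[in RHS](sqr_sqrtr (sqn_ge0 x)).
by rewrite ltr_pXn2r// nnegrE ?sqrtr_ge0// ltW.
Qed.

Lemma gt0_complex c : 0 < c -> exists2 e : R, 0 < e & c = e%:C.
Proof.
case: c => a b; rewrite ltcE /= => /andP[/eqP b0 a0].
by exists a => //; rewrite b0.
Qed.

Lemma sqn_complete (u : nat -> H) :
  (forall e : R, 0 < e -> exists N, forall n m, (N <= n)%N -> (N <= m)%N ->
    sqn (u n - u m) < e) ->
  exists z, forall e : R, 0 < e ->
    exists N, forall n, (N <= n)%N -> sqn (u n - z) < e.
Proof.
move=> uC; have : cvg (u @ \oo).
  apply/cauchy_cvgP/cauchyP => e /gt0_complex[a a0 ->].
  have [N uN] := uC (a ^+ 2) (exprn_gt0 _ a0).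
  exists (u N); exists N => // n /= Nn.
  by rewrite -ball_normE /= norm_lt// uN.
move=> /cvgrPdist_lt uz; exists (lim (u @ \oo)) => e e0.
have [|N _ uN] := uz (Num.sqrt e)%:C; first by rewrite ltcR sqrtr_gt0.
exists N => n /uN; rewrite norm_lt ?sqrtr_gt0// sqr_sqrtr ?ltW//.
by rewrite -sqnN opprB.
Qed.

Lemma sqn_parallelogram x y : sqn (x + y) <= 2 * (sqn x + sqn y).
Proof. by have := sqn_ge0 (x - y); rewrite sqn_sub sqn_add; lra. Qed.

Lemma sqc_add c d : sqc (c + d) <= 2 * (sqc c + sqc d).
Proof.
case: c => a b; case: d => e f; rewrite /sqc /=.
by have := sqr_ge0 (a - e); have := sqr_ge0 (b - f); nra.
Qed.

(** The discriminant argument, shared by the inner product and the form of a positive operator: the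
    minimum over [c] is at [c = d / b]. *)
Lemma quadratic_cauchy_schwarz (a b : R) (d : R[i]) : 0 <= b ->
  (forall c, 0 <= a + sqc c * b - 2 * complex.Re (c^*%C * d)) ->
  sqc d <= a * b.
Proof.
move=> b0 h; have [b_eq0|b_neq0] := eqVneq b 0; last first.
  have bpos : 0 < b by rewrite lt_neqAle eq_sym b_neq0.
  have := h (b^-1%:C * d); rewrite sqcM sqc_real.
  have -> : complex.Re ((b^-1%:C * d)^*%C * d) = b^-1 * sqc d.
    by case: d {h} => p q; rewrite /sqc /=; ring.
  move=> h1; have := mulr_ge0 b0 h1.
  have -> : b * (a + b^-1 ^+ 2 * sqc d * b - 2 * (b^-1 * sqc d)) =
            a * b - sqc d by field.
  by rewrite subr_ge0.
rewrite b_eq0 mulr0 in h *.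
rewrite leNgt; apply/negP => d0.
(* With [b = 0] the hypothesis is affine in [c]: this multiple of [d] gives 0 <= a - 2(a + 1), while
   [c = 0] gives 0 <= a. *)
have := h (((a + 1) / sqc d)%:C * d).
have -> : complex.Re ((((a + 1) / sqc d)%:C * d)^*%C * d) = a + 1.
  have : sqc d != 0 by rewrite gt_eqF.
  by case: d {h d0} => p q; rewrite /sqc /= => ?; field.
have := h 0; rewrite !mulr0 conjc0 mul0r /=; lra.
Qed.

Lemma cauchy_schwarz x y : sqc (inner x y) <= sqn x * sqn y.
Proof.
apply: quadratic_cauchy_schwarz (sqn_ge0 y) _ => c.
by have := sqn_ge0 (x - c *: y); rewrite sqn_sub sqnZ innerZr.
Qed.

End Basics.

(** * Orthonormal sets *)

Definition finsub (T : choiceType) (B : set T) (s : seq T) : Prop :=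
  uniq s /\ forall e, e \in s -> B e.

Section Orthonormal.
Variables (R : realType) (H : hilbert R).
Implicit Types (x y z : H) (c : H -> R[i]) (B : set H) (s : seq H).

Definition orthonormal_set B : Prop :=
  (forall e, B e -> inner e e = 1) /\
  (forall e f, B e -> B f -> e != f -> inner e f = 0).

Definition lincomb s c : H := \sum_(e <- s) c e *: e.

Lemma orthonormal_inner B e f : orthonormal_set B -> B e -> B f ->
  inner e f = (e == f)%:R.
Proof.
move=> [B1 B0] Be Bf; have [<-|ef] := eqVneq e f; first exact: B1.
exact: B0.
Qed.

Lemma inner_lincomb_seq B s c e : orthonormal_set B -> finsub B s ->
  B e -> inner (lincomb s c) e = if e \in s then c e else 0.
Proof.
move=> oB [us sB] Be; rewrite inner_suml.
under eq_big_seq => f fs.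
  rewrite innerZl (orthonormal_inner oB (sB _ fs) Be) mulr_natr mulrb.
  over.
rewrite /= -big_mkcond /=; case: ifPn => es.
  by rewrite -big_filter filter_pred1_uniq// big_seq1.
by rewrite big_seq_cond big1// => f /andP[fs /eqP fe]; rewrite -fe fs in es.
Qed.

Lemma inner_lincomb_sum s c x :
  inner x (lincomb s c) = \sum_(e <- s) (c e)^*%C * inner x e.
Proof. by rewrite inner_sumr; under eq_bigr do rewrite innerZr. Qed.

Lemma sqn_lincomb B s c : orthonormal_set B -> finsub B s ->
  sqn (lincomb s c) = \sum_(e <- s) sqc (c e).
Proof.
move=> oB fs; apply: (@complexI R).
rewrite -sqnE inner_lincomb_sum rmorph_sum; apply: eq_big_seq => e es /=.
rewrite (inner_lincomb_seq _ oB fs) ?es; last by case: fs => _; exact.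
by rewrite sqcE mulrC.
Qed.

Lemma sqn_residual B s x : orthonormal_set B -> finsub B s ->
  sqn (x - lincomb s (inner x)) = sqn x - \sum_(e <- s) sqc (inner x e).
Proof.
move=> oB fs; rewrite sqn_sub (sqn_lincomb _ oB fs).
have -> : complex.Re (inner x (lincomb s (inner x))) =
          \sum_(e <- s) sqc (inner x e).
  rewrite inner_lincomb_sum.
  have -> : \sum_(e <- s) (inner x e)^*%C * inner x e =
            (\sum_(e <- s) sqc (inner x e))%:C.
    by rewrite rmorph_sum; apply: eq_bigr => e _; rewrite /= sqcE mulrC.
  by [].
ring.
Qed.

Lemma bessel_seq B s x : orthonormal_set B -> finsub B s ->
  \sum_(e <- s) sqc (inner x e) <= sqn x.
Proof.
move=> oB fs; have := sqn_ge0 (x - lincomb s (inner x)).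
by rewrite (sqn_residual _ oB fs) subr_ge0.
Qed.

Lemma ler_sum_sub (I : eqType) (s t : seq I) (a : I -> R) : uniq s ->
  (forall e, e \in s -> e \in t) -> (forall e, e \in t -> 0 <= a e) ->
  \sum_(e <- s) a e <= \sum_(e <- t) a e.
Proof.
elim: s t => [|e s IHs] t.
  by move=> _ _ a0; rewrite big_nil big_seq sumr_ge0.
move=> /= /andP[es us] st a0; have et : e \in t by rewrite st ?mem_head.
rewrite big_cons (big_rem e et) /= lerD2l; apply: IHs => // f fs.
  have := st f; rewrite in_cons fs orbT => /(_ isT).
  rewrite (perm_mem (perm_to_rem et)) in_cons => /orP[/eqP fe|//].
  by rewrite -fe fs in es.
exact/a0/(mem_rem fs).
Qed.

Lemma finsub_undup_cat B s t : finsub B s -> finsub B t ->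
  finsub B (undup (s ++ t)).
Proof.
move=> [_ sB] [_ tB]; split; first exact: undup_uniq.
by move=> e; rewrite mem_undup mem_cat => /orP[/sB|/tB].
Qed.

Lemma sqn_lincomb_sub B s t c : orthonormal_set B -> finsub B s ->
  finsub B t -> (forall e, e \in s -> e \in t) ->
  sqn (lincomb t c - lincomb s c) =
  \sum_(e <- t) sqc (c e) - \sum_(e <- s) sqc (c e).
Proof.
move=> oB fs ft st; rewrite sqn_sub (sqn_lincomb _ oB fs) (sqn_lincomb _ oB ft).
rewrite inner_lincomb_sum.
have -> : \sum_(e <- s) (c e)^*%C * inner (lincomb t c) e =
            (\sum_(e <- s) sqc (c e))%:C.
  rewrite rmorph_sum; apply: eq_big_seq => e es; rewrite /= sqcE mulrC.
  by rewrite (inner_lincomb_seq _ oB ft) ?st//; case: fs => _; exact.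
rewrite /=; ring.
Qed.

Lemma lt_small_eq0 (a : R) : 0 <= a -> (forall e : R, 0 < e -> a < e) -> a = 0.
Proof.
move=> a0 h; apply/eqP; rewrite eq_le a0 andbT leNgt; apply/negP => /h.
by rewrite ltxx.
Qed.

(* Riesz-Fischer; the partial sums indexed by a maximizing sequence of finite
   subsets of B form a Cauchy sequence, so B may be uncountable. *)
Lemma riesz_fischer B c (M : R) : orthonormal_set B ->
  (forall s, finsub B s -> \sum_(e <- s) sqc (c e) <= M) ->
  exists z, (forall e, B e -> inner z e = c e) /\
    forall d : R, 0 < d -> exists2 s, finsub B s & sqn (z - lincomb s c) < d.
Proof.
move=> oB cM.
pose A := [set a : R | exists2 s, finsub B s & a = \sum_(e <- s) sqc (c e)].
have supA : has_sup A.
  split; first by exists 0, [::]; rewrite ?big_nil.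
  by exists M => _ [s fs ->]; exact: cM.
have ubA s : finsub B s -> \sum_(e <- s) sqc (c e) <= sup A.
  by move=> fs; apply: ub_le_sup; [case: supA|exists s].
have /choice[s_ s_P] : forall n, exists s, finsub B s /\
    sup A - n.+1%:R^-1 < \sum_(e <- s) sqc (c e).
  move=> n; have n0 : 0 < n.+1%:R^-1 :> R by rewrite invr_gt0.
  by have [_ [s fs ->] h] := sup_adherent n0 supA; exists s.
pose t_ := fix t_ n := if n is m.+1 then undup (t_ m ++ s_ n) else s_ 0%N.
have t_fin n : finsub B (t_ n).
  elim: n => [|n IHn] /=; first by case: (s_P 0%N).
  by apply: finsub_undup_cat => //; case: (s_P n.+1).
have t_mono n m : (n <= m)%N -> forall e, e \in t_ n -> e \in t_ m.
  move=> /subnK <-; elim: (m - n)%N => //= k IHk e /IHk h.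
  by rewrite mem_undup mem_cat h.
have s_t n e : e \in s_ n -> e \in t_ n.
  by case: n => //= n h; rewrite mem_undup mem_cat h orbT.
have t_large n : sup A - n.+1%:R^-1 < \sum_(e <- t_ n) sqc (c e).
  have [fs /lt_le_trans] := s_P n; apply; apply: ler_sum_sub => //.
  - by case: fs.
  - exact: s_t.
  - by move=> e _; exact: sqc_ge0.
have small (e : R) : 0 < e -> exists N, forall n, (N <= n)%N -> n.+1%:R^-1 < e.
  move=> e0; have /cvgrPdist_lt/(_ _ e0)[N _ h] := @cvg_harmonic R.
  exists N => n /h; rewrite sub0r normrN gtr0_norm//.
  by rewrite invr_gt0.
have u_close n m : (n <= m)%N ->
    sqn (lincomb (t_ m) c - lincomb (t_ n) c) < n.+1%:R^-1.
  move=> nm; rewrite (sqn_lincomb_sub _ oB)//; last exact: t_mono.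
  by rewrite ltrBlDl (le_lt_trans (ubA _ (t_fin m)))// -ltrBlDr t_large.
have [z zP] : exists z, forall e : R, 0 < e ->
    exists N, forall n, (N <= n)%N -> sqn (lincomb (t_ n) c - z) < e.
  apply: sqn_complete => e e0; have [N hN] := small e e0.
  exists N => n m Nn Nm; have [nm|/ltnW mn] := leqP n m.
    by rewrite -sqnN opprB (lt_trans (u_close _ _ nm))// hN.
  by rewrite (lt_trans (u_close _ _ mn))// hN.
exists z; split=> [e Be|d d0]; last first.
  have [N hN] := zP _ d0; exists (t_ N) => //.
  by rewrite -sqnN opprB hN.
apply/eqP; rewrite -subr_eq0 -sqc_eq0; apply/eqP/lt_small_eq0 => [|d d0].
  exact: sqc_ge0.
have d4 : 0 < d / 4 by rewrite divr_gt0.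
have [N1 h1] := zP _ d4; have [N2 h2] := small _ d4.
pose n := maxn N1 N2; have {}h1 := h1 n (leq_maxl _ _).
have {}h2 := h2 n (leq_maxr _ _).
have -> : inner z e - c e = inner (z - lincomb (t_ n) c) e +
    (inner (lincomb (t_ n) c) e - c e) by rewrite innerBl; ring.
have k1 : sqc (inner (z - lincomb (t_ n) c) e) < d / 4.
  apply: le_lt_trans (cauchy_schwarz _ _) _.
  have -> : sqn e = 1 by rewrite /sqn (oB.1 _ Be).
  by rewrite mulr1 -sqnN opprB.
have k2 : sqc (inner (lincomb (t_ n) c) e - c e) < d / 4.
  rewrite (inner_lincomb_seq _ oB (t_fin n) Be); case: ifPn => et.
    by rewrite subrr sqc0.
  (* Adjoining [e] keeps the partial sum below [sup A], which [t_ n] misses by less than 1/(n + 1);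
     hence [sqc (c e)] is below 1/(n + 1). *)
  have fe : finsub B (e :: t_ n).
    split; first by rewrite /= et; case: (t_fin n).
    by move=> f; rewrite inE => /predU1P[->//|]; case: (t_fin n) => _; exact.
  rewrite sub0r -[- c e]mulN1r sqcM.
  have -> : sqc (-1 : R[i]) = 1 :> R by rewrite /sqc /=; ring.
  rewrite mul1r (le_lt_trans _ h2)//.
  move: (ubA _ fe) (t_large n); rewrite big_cons; move: (\sum_(e <- t_ n) _) => b.
  by move: (n.+1%:R^-1) => a; lra.
by have := sqc_add (inner (z - lincomb (t_ n) c) e)
  (inner (lincomb (t_ n) c) e - c e); lra.
Qed.

Definition total_set B : Prop := forall x, (forall e, B e -> inner x e = 0) -> x = 0.

Lemma orthonormal_basisP B :
  orthonormal_basis B <-> orthonormal_set B /\ total_set B.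
Proof. by split=> [[? ? ?]|[[? ?] ?]]. Qed.

Lemma total_eq B x y : total_set B ->
  (forall e, B e -> inner x e = inner y e) -> x = y.
Proof.
move=> tB h; apply/eqP; rewrite -subr_eq0; apply/eqP/tB => e Be.
by rewrite innerBl h// subrr.
Qed.

Lemma parseval_approx B x (d : R) : orthonormal_basis B -> 0 < d ->
  exists2 s, finsub B s & sqn (x - lincomb s (inner x)) < d.
Proof.
move=> /orthonormal_basisP[oB tB] d0.
have [z [zx zd]] := riesz_fischer oB (fun s => bessel_seq x oB).
have <- : z = x by exact: total_eq zx.
have [s fs] := zd _ d0; exists s => //.
suff : lincomb s (inner x) = lincomb s (inner z) by move=> <-.
by apply: eq_big_seq => e es; rewrite zx//; case: fs => _; exact.
Qed.

(** The diagonal operator with weights [w] in the basis [B]. Spectral projections, square roots and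
    the projection off a set of eigenvectors are all instances. *)
Definition coord_op B (w : H -> R) : H -> H :=
  get [set T : H -> H |
    forall x e, B e -> inner (T x) e = (w e)%:C * inner x e].

Lemma coord_opP B (w : H -> R) (C : R) : orthonormal_basis B ->
  0 <= C -> (forall e, B e -> w e ^+ 2 <= C) ->
  forall x e, B e -> inner (coord_op B w x) e = (w e)%:C * inner x e.
Proof.
move=> bB C0 wC; have /orthonormal_basisP[oB tB] := bB.
have /choice[T TP] : forall x, exists z, forall e, B e ->
    inner z e = (w e)%:C * inner x e.
  move=> x; have [|z [zP _]] :=
    @riesz_fischer B (fun e => (w e)%:C * inner x e) (C * sqn x) oB.
    move=> s fs.
    apply: (@le_trans _ _ (\sum_(e <- s) C * sqc (inner x e))).
      rewrite !big_seq; apply: ler_sum => e es; rewrite sqcM sqc_real.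
      by rewrite ler_wpM2r ?sqc_ge0// wC//; case: fs => _; exact.
    by rewrite -mulr_sumr ler_wpM2l// (bessel_seq x oB).
  by exists z.
apply: (@getPex _ [set T : H -> H | forall x e, B e ->
  inner (T x) e = (w e)%:C * inner x e]).
by exists T.
Qed.

End Orthonormal.

(** * Bases, Parseval and Riesz representation *)

Section FiniteSums.
Variables (R : realType) (T : choiceType).
Implicit Types (B : set T) (s : seq T) (a : T -> R).

Lemma esum_ge_finsub B s a : finsub B s ->
  ((\sum_(e <- s) a e)%:E <= \esum_(e in B) (a e)%:E)%E.
Proof.
move=> [us sB]; apply: esum_ge; exists [set` s].
  by split; [exact: finite_seq|move=> e /=; exact: sB].
by rewrite -fsbig_seq// sumEFin.
Qed.

Lemma esum_le_finsub B a (M : \bar R) :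
  (forall s, finsub B s -> ((\sum_(e <- s) a e)%:E <= M)%E) ->
  (\esum_(e in B) (a e)%:E <= M)%E.
Proof.
move=> aM; apply: ge_ereal_sup => _ [X [finX XB] <-].
rewrite fsbig_finite//= sumEFin; apply: aM; split; first exact: fset_uniq.
by move=> e; rewrite in_fset_set// => /set_mem/XB.
Qed.

Lemma esum_fine_le B a (M : R) :
  (forall s, finsub B s -> \sum_(e <- s) a e <= M) ->
  (\esum_(e in B) (a e)%:E <= M%:E)%E.
Proof. by move=> aM; apply: esum_le_finsub => s fs; rewrite lee_fin aM. Qed.

Lemma esum_finsub_approx B a (M d : R) : 0 < d ->
  \esum_(e in B) (a e)%:E = M%:E ->
  exists2 s, finsub B s & M - d < \sum_(e <- s) a e.
Proof.
move=> d0 aM; apply: contrapT => h.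
suff : (M%:E <= (M - d)%:E)%E by rewrite lee_fin; lra.
rewrite -aM; apply: esum_fine_le => s fs; rewrite leNgt; apply/negP => hs.
by apply: h; exists s.
Qed.

Lemma esum_nneg_fine B a : (forall e, B e -> 0 <= a e) ->
  (\esum_(e in B) (a e)%:E < +oo)%E ->
  \esum_(e in B) (a e)%:E = (fine (\esum_(e in B) (a e)%:E))%:E.
Proof.
move=> a0 h; rewrite fineK// ge0_fin_numE//.
by apply: esum_ge0 => e Be; rewrite lee_fin a0.
Qed.

Lemma esum_exchange (T' : choiceType) B (C : set T') (a : T -> T' -> \bar R) :
  (forall i j, B i -> C j -> (0 <= a i j)%E) ->
  \esum_(i in B) \esum_(j in C) a i j = \esum_(j in C) \esum_(i in B) a i j.
Proof.
move=> a0; rewrite !esum_esum//; last by move=> j i Cj Bi; exact: a0.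
rewrite (reindex_esum (C `*`` fun=> B) _ (fun x => (x.2, x.1)))//; split=> //=.
- by move=> [i j] [/=].
- by move=> [i1 i2] [j1 j2] /= _ _ [] -> ->.
- by move=> [i1 i2] [/= Bi Cj]; exists (i2, i1).
Qed.

End FiniteSums.

Section Hilbert.
Variables (R : realType) (H : hilbert R).
Implicit Types (x y z : H) (B : set H) (s : seq H).

(** With [P] everything this gives bases, with [P] the eigenvectors of an operator it gives the
    eigenbasis. Stability under scalars allows a new vector to be normalized inside [P]. *)
Lemma orthonormal_maximal (P : set H) B0 :
  (forall (a : R[i]) x, P x -> P (a *: x)) ->
  orthonormal_set B0 -> B0 `<=` P ->
  exists B, [/\ B0 `<=` B, B `<=` P, orthonormal_set B &
    forall x, P x -> (forall e, B e -> inner x e = 0) -> x = 0].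
Proof.
move=> PZ oB0 B0P.
(* [B0] is built into the condition on [C] so that the empty chain, whose union is empty, satisfies
   it too. *)
pose Q := [set C : set H | orthonormal_set (B0 `|` C) /\ C `<=` P].
have [F FQ Ftot|C [[oC CP] Cmax]] := @Zorn_bigcup H Q.
  split; last by move=> x [C FC Cx]; have [_] := FQ _ FC; exact.
  split=> [e [B0e|[C FC Ce]]|].
  - exact: oB0.1.
  - by have [[+ _] _] := FQ _ FC; apply; right.
  - have one C e f : F C -> (B0 `|` C) e -> (B0 `|` C) f -> e != f -> inner e f = 0.
      by move=> FC; have [[_ h] _] := FQ _ FC; exact: h.
    move=> e f [B0e|[C FC Ce]] [B0f|[D FD Df]] ef.
    + exact: oB0.2.
    + by apply: (one D) => //; [left|right].
    + by apply: (one C) => //; [right|left].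
    + have [CD|DC] := Ftot _ _ FC FD.
        by apply: (one D) => //; right => //; exact: CD.
      by apply: (one C) => //; right => //; exact: DC.
exists (B0 `|` C); split=> [x|x [/B0P|/CP]||x Px xB] //; first by left.
apply: contrapT => /eqP x0.
have nx0 : 0 < sqn x by rewrite lt_neqAle sqn_ge0 eq_sym sqn_eq0 x0.
pose a : R[i] := (Num.sqrt (sqn x))^-1%:C; pose u := a *: x.
have uB e : (B0 `|` C) e -> inner u e = 0.
  by move=> Be; rewrite innerZl xB// mulr0.
have uu : inner u u = 1.
  rewrite sqnE sqnZ sqc_real exprVn sqr_sqrtr ?sqn_ge0// mulVf//.
  by rewrite gt_eqF.
have Cu : ~ C u.
  by move=> Cu; have := uB u (or_intror Cu); rewrite uu => /eqP; rewrite oner_eq0.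
apply: (Cmax (C `|` [set u])).
  by split=> [y Cy|/(_ u (or_intror erefl))//]; left.
split; last by move=> y [/CP//|->]; exact: PZ.
have [oC1 oC0] := oC.
split=> [e|e f]; rewrite setUA.
  by case=> [/oC1//|->].
case=> [Be|->] [Bf|->] ef //; last by rewrite eqxx in ef.
- exact: oC0.
- by rewrite innerC uB// conjc0.
- exact: uB.
Qed.

Lemma orthonormal_extension B0 : orthonormal_set B0 ->
  exists2 B, B0 `<=` B & orthonormal_basis B.
Proof.
move=> oB0; have [//|//|//|B [B0B _ oB tB]] := @orthonormal_maximal setT B0.
by exists B => //; apply/orthonormal_basisP; split=> // x; exact: tB.
Qed.

Lemma hilbert_basisP : orthonormal_basis (@hilbert_basis R H).
Proof.
have [|B _ bB] := @orthonormal_extension set0; first by split.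
by apply: (@getPex _ (@orthonormal_basis R H)); exists B.
Qed.

Lemma parseval B x : orthonormal_basis B ->
  \esum_(e in B) (sqc (inner x e))%:E = (sqn x)%:E.
Proof.
move=> bB; have /orthonormal_basisP[oB _] := bB.
apply/eqP; rewrite eq_le; apply/andP; split.
  by apply: esum_fine_le => s; exact: bessel_seq.
apply/lee_addgt0Pr => d d0; have [s fs hs] := parseval_approx x bB d0.
have := esum_ge_finsub (fun e => sqc (inner x e)) fs.
move: hs; rewrite (sqn_residual _ oB fs).
case: (\esum_(_ in _) _) => [M|//|//]; rewrite ?lee_fin ?leey//.
by lra.
Qed.

(** The candidate has the conjugates of the values [phi e] as coordinates. They are square summable:
    at a partial sum p, [phi p] equals |p|^2, so |p|^4 <= C |p|^2. *)
Lemma riesz B (phi : H -> R[i]) (C : R) : orthonormal_basis B -> scalar phi ->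
  0 <= C -> (forall x, sqc (phi x) <= C * sqn x) ->
  exists z, forall x, phi x = inner x z.
Proof.
move=> bB lphi C0 phiC; have /orthonormal_basisP[oB tB] := bB.
have phi0 : phi 0 = 0.
  by have := lphi (-1) 0 0; rewrite scaler0 addr0 mulN1r addNr.
have phiD x y : phi (x + y) = phi x + phi y.
  by have := lphi 1 x y; rewrite scale1r mul1r.
have phiZ a x : phi (a *: x) = a * phi x.
  by have := lphi a x 0; rewrite !addr0 phi0 addr0.
have philin s c : phi (lincomb s c) = \sum_(e <- s) c e * phi e.
  rewrite /lincomb; elim: s => [|e s IH]; first by rewrite !big_nil.
  by rewrite !big_cons phiD phiZ IH.
have [|z [zP _]] := @riesz_fischer _ _ B (fun e => (phi e)^*%C) C oB.
  move=> s fs; set p := lincomb s (fun e => (phi e)^*%C).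
  have : phi p = (sqn p)%:C.
    rewrite philin (sqn_lincomb _ oB fs) rmorph_sum; apply: eq_bigr => e _.
    by rewrite /= sqcE conjcK.
  rewrite -(sqn_lincomb _ oB fs) -/p => pp.
  have := phiC p; rewrite pp sqc_real expr2.
  have [->|p0] := eqVneq (sqn p) 0; first by rewrite mulr0.
  by rewrite ler_pM2r// lt_neqAle eq_sym p0 sqn_ge0.
exists z => x; apply/eqP; rewrite -subr_eq0 -sqc_eq0; apply/eqP/lt_small_eq0.
  exact: sqc_ge0.
move=> d d0; pose K := 2 * (C + sqn z) + 1.
have K0 : 0 < K by rewrite /K; have := sqn_ge0 z; lra.
have [s fs hs] := parseval_approx x bB (divr_gt0 d0 K0).
set p := lincomb s (inner x) in hs.
have -> : phi x - inner x z = phi (x - p) + inner (- (x - p)) z.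
  have -> : phi (x - p) = phi x - phi p.
    by rewrite phiD -scaleN1r phiZ mulN1r.
  rewrite opprB innerBl.
  suff -> : phi p = inner p z by ring.
  rewrite philin innerC inner_lincomb_sum rmorph_sum; apply: eq_big_seq => e es.
  rewrite rmorphM /= conjcK zP ?conjcK; last by case: fs => _; exact.
  by [].
have h1 := sqc_add (phi (x - p)) (inner (- (x - p)) z).
have h2 := phiC (x - p).
have h3 := cauchy_schwarz (- (x - p)) z; rewrite sqnN in h3.
move: hs; rewrite ltr_pdivlMr// /K => hs.
have := sqn_ge0 (x - p); move: (sqn (x - p)) hs h2 h3 => t; nra.
Qed.

End Hilbert.

(** * Adjoints and positive operators *)

Section LinearProp.
Variables (K : pzRingType) (U V : lmodType K) (T : U -> V).
Hypothesis lT : linear T.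

Lemma lin0 : T 0 = 0.
Proof. by have := lT (-1) 0 0; rewrite scaler0 addr0 scaleN1r addNr. Qed.

Lemma linD x y : T (x + y) = T x + T y.
Proof. by have := lT 1 x y; rewrite !scale1r. Qed.

Lemma linZ a x : T (a *: x) = a *: T x.
Proof. by have := lT a x 0; rewrite !addr0 lin0 addr0. Qed.

Lemma linN x : T (- x) = - T x.
Proof. by rewrite -scaleN1r linZ scaleN1r. Qed.

Lemma linB x y : T (x - y) = T x - T y.
Proof. by rewrite linD linN. Qed.

Lemma lin_sum I (r : seq I) (P : pred I) (F : I -> U) :
  T (\sum_(i <- r | P i) F i) = \sum_(i <- r | P i) T (F i).
Proof. exact: (big_morph T linD lin0). Qed.

End LinearProp.

Section Operators.
Variables (R : realType) (H G : hilbert R).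
Implicit Types (T : H -> G).

Definition bounded_op T : Prop :=
  exists2 C : R, 0 <= C & forall x, sqn (T x) <= C * sqn x.

Lemma linear_bundle T : linear T -> exists T' : {linear H -> G}, T' = T :> (H -> G).
Proof.
move=> lT; pose m := GRing.isLinear.Build _ _ _ _ T lT.
pose T' : {linear H -> G} := HB.pack T m.
by exists T'.
Qed.

Lemma continuous_bounded_op T : linear T -> continuous T -> bounded_op T.
Proof.
move=> /linear_bundle[{}T <-] cT.
have /linear_bounded_continuous/linear_boundedP/pinfty_ex_gt0[r r0 rT] := cT.
have [e e0 re] := gt0_complex r0; exists (e ^+ 2) => [|x]; first exact: sqr_ge0.
have := rT x; rewrite re !sqn_norm -rmorphM lecR => h.
rewrite -(sqr_sqrtr (sqn_ge0 (T x))) -(sqr_sqrtr (sqn_ge0 x)) -exprMn.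
by rewrite ler_pXn2r// ?nnegrE ?mulr_ge0 ?sqrtr_ge0// ltW.
Qed.

Lemma bounded_op_continuous T : linear T -> bounded_op T -> continuous T.
Proof.
move=> /linear_bundle[{}T <-] [C C0 CT].
apply/linear_bounded_continuous/linear_boundedP; exists (Num.sqrt C)%:C; split.
  by apply/complex_realP; exists (Num.sqrt C).
move=> r hr x; have {hr} : (Num.sqrt C)%:C < r := hr.
move=> /ltW /(ler_wpM2r (normr_ge0 x)); apply: le_trans.
rewrite !sqn_norm -rmorphM lecR -sqrtrM// ler_wsqrtr//.
Qed.

Lemma adjointP (K : H -> G) : linear K -> bounded_op K ->
  forall x y, inner (K x) y = inner x (adjoint K y).
Proof.
move=> lK [C C0 CK].
have /choice[A AP] : forall y, exists z, forall x, inner (K x) y = inner x z.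
  move=> y; apply: (@riesz _ _ _ (fun x => inner (K x) y) (C * sqn y)
      (hilbert_basisP H)).
  - by move=> a u v; rewrite (linD lK) (linZ lK) innerDl innerZl.
  - by rewrite mulr_ge0// sqn_ge0.
  - move=> x; apply: le_trans (cauchy_schwarz _ _) _.
    by rewrite mulrAC ler_wpM2r ?sqn_ge0.
suff: [set T' : G -> H | forall x y, inner (K x) y = inner x (T' y)] (adjoint K).
  by [].
by apply: getPex; exists A => x y; exact: AP.
Qed.

End Operators.

Lemma inner_eqP (R : realType) (H : hilbert R) (x y : H) :
  (forall z, inner z x = inner z y) -> x = y.
Proof.
move=> h; apply/eqP; rewrite -subr_eq0 -sqn_eq0; apply/eqP.
by rewrite /sqn innerBr h subrr.
Qed.

Section AdjointPair.
Variables (R : realType) (H G : hilbert R) (T : H -> G) (T' : G -> H).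
Hypothesis TT' : forall x y, inner (T x) y = inner x (T' y).

Lemma adjoint_sym x y : inner (T' y) x = inner y (T x).
Proof. by rewrite innerC -TT' -innerC. Qed.

Lemma adjoint_linear : linear T'.
Proof.
move=> a u v; apply: inner_eqP => z.
by rewrite -TT' !innerDr !innerZr -!TT'.
Qed.

(** Both sides equal the double sum of |<T e, g>|^2 over [B] and [C]. *)
Lemma hs_swap (B : set H) (C : set G) :
  orthonormal_basis B -> orthonormal_basis C ->
  \esum_(e in B) (sqn (T e))%:E = \esum_(g in C) (sqn (T' g))%:E.
Proof.
move=> bB bC.
transitivity (\esum_(e in B) \esum_(g in C) (sqc (inner (T e) g))%:E).
  by apply: eq_esum => e _; rewrite parseval.
rewrite esum_exchange; last by move=> *; rewrite lee_fin sqc_ge0.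
apply: eq_esum => g _; rewrite -(parseval _ bB); apply: eq_esum => e _.
by rewrite sqc_inner adjoint_sym -sqc_inner.
Qed.

(** Covers vectors outside the chosen basis: after passing to [T'], each [g] contributes a Bessel
    inequality for [T' g]. *)
Lemma hs_orthonormal_le (B : set H) (C : set G) (D : set H) (s : seq H) :
  orthonormal_basis B -> orthonormal_basis C -> orthonormal_set D ->
  finsub D s ->
  ((\sum_(v <- s) sqn (T v))%:E <= \esum_(e in B) (sqn (T e))%:E)%E.
Proof.
move=> bB bC oD fs; rewrite (hs_swap bB bC).
have -> : (\sum_(v <- s) sqn (T v))%:E =
    (\sum_(v <- s) \esum_(g in C) (sqc (inner v (T' g)))%:E)%E.
  rewrite -sumEFin; apply: eq_bigr => v _; rewrite -(parseval _ bC).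
  by apply: eq_esum => g _; rewrite TT'.
rewrite -esum_sum; last by move=> *; rewrite lee_fin sqc_ge0.
apply: le_esum => g _; rewrite sumEFin lee_fin.
under eq_bigr do rewrite sqc_inner.
exact: bessel_seq oD fs.
Qed.

End AdjointPair.

Section Positive.
Variables (R : realType) (H : hilbert R) (T : H -> H).
Hypotheses (lT : linear T) (pT : positive_op T).
Implicit Types (x y : H) (B : set H) (s : seq H).

Definition qform (T : H -> H) x : R := complex.Re (inner (T x) x).

Lemma qformE x : inner (T x) x = (qform T x)%:C.
Proof.
rewrite /qform; have /ger0_Im := pT x.
by case: (inner (T x) x) => a b /= ->.
Qed.

Lemma qform_ge0 x : 0 <= qform T x.
Proof. by rewrite -ler0c -qformE. Qed.

(** Polarization: the imaginary parts of the form at [x + y] and at [x + i y] vanish, which gives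
    both components of the identity. *)
Lemma positive_selfadjoint x y : inner (T x) y = inner x (T y).
Proof.
have im z : complex.Im (inner (T z) z) = 0 by rewrite qformE.
have := im (x + y); rewrite (linD lT) innerDl !innerDr.
have := im (x + 'i *: y); rewrite (linD lT) (linZ lT) innerDl !innerDr.
rewrite !innerZl !innerZr.
have := im x; have := im y; rewrite [inner x (T y)]innerC.
case: (inner (T x) x) => ? ?; case: (inner (T y) y) => ? ?.
case: (inner (T x) y) => a b; case: (inner (T y) x) => c d /= -> -> h1 h2.
by apply/eqP; rewrite eq_complex /=; apply/andP; split; apply/eqP; lra.
Qed.

Lemma positive_cauchy_schwarz x y :
  sqc (inner (T x) y) <= qform T x * qform T y.
Proof.
apply: quadratic_cauchy_schwarz (qform_ge0 y) _ => c.
have := qform_ge0 (x - c *: y).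
rewrite /qform (linB lT) (linZ lT) innerBl !innerBr !innerZl !innerZr.
have -> : inner (T y) x = (inner (T x) y)^*%C.
  by rewrite positive_selfadjoint -innerC.
case: (inner (T x) x) => ? ?; case: (inner (T y) y) => ? ?.
case: (inner (T x) y) => ? ?; case: c => ? ?; rewrite /sqc /=.
move=> h; apply: le_trans h _; rewrite le_eqVlt; apply/orP; left; apply/eqP.
ring.
Qed.

(* Parseval applied to [T x], with the Cauchy-Schwarz inequality of the
   positive form of [T] in each coordinate. *)
Lemma trace_bound_sqn B (M : R) : orthonormal_basis B ->
  (forall s, finsub B s -> \sum_(e <- s) qform T e <= M) ->
  forall x, sqn (T x) <= M * qform T x.
Proof.
move=> bB TM x; rewrite -lee_fin -(parseval _ bB); apply: esum_fine_le => s fs.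
apply: (@le_trans _ _ (\sum_(e <- s) qform T x * qform T e)).
  by apply: ler_sum => e _; exact: positive_cauchy_schwarz.
by rewrite -mulr_sumr mulrC ler_wpM2r ?qform_ge0// TM.
Qed.

(** With q = <T x, x>, one has q^2 <= |T x|^2 |x|^2 <= M q |x|^2. *)
Lemma trace_bound B (M : R) : orthonormal_basis B ->
  (forall s, finsub B s -> \sum_(e <- s) qform T e <= M) ->
  forall x, qform T x <= M * sqn x.
Proof.
move=> bB TM x; have := trace_bound_sqn bB TM x => h.
have := cauchy_schwarz (T x) x; rewrite qformE sqc_real.
have [->|q0] := eqVneq (qform T x) 0.
  rewrite mulr_ge0 ?sqn_ge0//.
  by have := TM [::]; rewrite big_nil; apply; split.
have {q0} : 0 < qform T x by rewrite lt_neqAle eq_sym q0 qform_ge0.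
have := sqn_ge0 x; move: (sqn x) (sqn (T x)) (qform T x) h => n m q h n0 q0 h2.
by rewrite -(ler_pM2l q0) -expr2; apply: le_trans h2 _; nra.
Qed.

(** Cauchy-Schwarz for the form at [x] and [T x]: |T x|^4 <= <T x, x> <T (T x), T x> <= <T x, x> |T
    x|^2. *)
Lemma contraction_qform x : (forall z, qform T z <= sqn z) ->
  sqn (T x) <= qform T x.
Proof.
move=> h; have := positive_cauchy_schwarz x (T x).
rewrite sqnE sqc_real expr2 => h1; have {}h := h (T x).
have [->|q0] := eqVneq (sqn (T x)) 0; first exact: qform_ge0.
have {q0} : 0 < sqn (T x) by rewrite lt_neqAle eq_sym q0 sqn_ge0.
move=> q0; rewrite -(ler_pM2r q0); apply: le_trans h1 _.
by rewrite ler_wpM2l ?qform_ge0.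
Qed.

End Positive.

(** * Eigenvectors of trace class positive operators *)

Section Eigenvector.
Variables (R : realType) (H : hilbert R).
Implicit Types (x y z : H) (B : set H) (s : seq H).

Section Iterates.
Variable A : H -> H.
Hypotheses (lA : linear A) (pA : positive_op A).
Hypothesis A_le1 : forall x, qform A x <= sqn x.

Let a n x : R := complex.Re (inner (iter n A x) x).

Lemma iter_linear n : linear (iter n A).
Proof. by elim: n => [//|n IHn] c u v; rewrite !iterS IHn lA. Qed.

Lemma iter_selfadjoint n x y : inner (iter n A x) y = inner x (iter n A y).
Proof.
elim: n x y => //= n IHn x y.
by rewrite (positive_selfadjoint lA pA) IHn -iterS iterSr.
Qed.

Let iter_inner m n x : inner (iter m A x) (iter n A x) = inner (iter (m + n) A x) x.
Proof. by rewrite addnC iterD [RHS]iter_selfadjoint. Qed.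

Let a_even k x : a (k + k) x = sqn (iter k A x).
Proof. by rewrite /a -iter_inner. Qed.

Let a_odd k x : a (k + k).+1 x = qform A (iter k A x).
Proof. by rewrite /a -addSn -iter_inner. Qed.

Let parity_cases n : exists k, n = (k + k)%N \/ n = (k + k).+1.
Proof.
exists n./2; have := odd_double_half n; rewrite -addnn.
by case: (odd n) => /= h; [right|left]; exact/esym.
Qed.

Let a_ge0 n x : 0 <= a n x.
Proof.
have [k [->|->]] := parity_cases n; first by rewrite a_even sqn_ge0.
by rewrite a_odd qform_ge0.
Qed.

Lemma contraction_sqn x : sqn (A x) <= sqn x.
Proof. exact: le_trans (contraction_qform lA pA x A_le1) (A_le1 x). Qed.

Let a_decr n x : a n.+1 x <= a n x.
Proof.
have [k [->|->]] := parity_cases n; first by rewrite a_odd a_even.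
have -> : (k + k).+2 = (k.+1 + k.+1)%N by rewrite addSn addnS.
by rewrite a_odd a_even /= contraction_qform.
Qed.

Let a_le m n x : (m <= n)%N -> a n x <= a m x.
Proof.
move=> /subnK <-; elim: (n - m)%N => // k IHk.
by rewrite addSn (le_trans (a_decr _ _)).
Qed.

(** The second difference of the moments at [x] is the moment of order [n] at [x - A x]. *)
Let a_convex n x : a n.+1 x - a n.+2 x <= a n x - a n.+1 x.
Proof.
have := a_ge0 n (x - A x).
have -> : a n (x - A x) = a n x - 2 * a n.+1 x + a n.+2 x; last by lra.
rewrite /a (linB (iter_linear n)) innerBl !innerBr -iterSr.
rewrite -[inner (iter n A x) (A x)](positive_selfadjoint lA pA).
rewrite -[inner (iter n.+1 A x) (A x)](positive_selfadjoint lA pA) -!iterS.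
move: (inner (iter n A x) x) (inner (iter n.+1 A x) x) (inner (iter n.+2 A x) x).
by move=> [? ?] [? ?] [? ?] /=; ring.
Qed.

(** By convexity no step loses more than the first. When the first loss is tiny, high moments stay
    close to |x|^2, which keeps the norm of a power of [A] away from 0. *)
Let a_lower n x : a 0%N x - n%:R * (a 0%N x - a 1%N x) <= a n x.
Proof.
have step k : a k x - a k.+1 x <= a 0%N x - a 1%N x.
  by elim: k => // k IHk; exact: le_trans (a_convex k x) IHk.
elim: n => [|n IHn]; first by rewrite mul0r subr0.
by have := step n; rewrite -natr1; lra.
Qed.

Let iter_cauchy x (e : R) : 0 < e -> exists N, forall n m, (N <= n)%N ->
  (N <= m)%N -> sqn (iter n A x - iter m A x) < e.
Proof.
move=> e0; pose S := [set a n x | n in [set: nat]].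
have infS : has_inf S.
  by split; [exists (a 0%N x), 0%N|exists 0 => _ [n _ <-]; exact: a_ge0].
have e2 : 0 < e / 2 by rewrite divr_gt0.
have [_ [N _ <-] hN] := inf_adherent e2 infS; exists N => n m Nn Nm.
have lb k : inf S <= a k x by apply: ge_inf; [case: infS|exists k].
have Nle k l : (N <= k)%N -> a (k + l)%N x <= a N x.
  by move=> Nk; apply: a_le; rewrite (leq_trans Nk)// leq_addr.
(* The squared distance is a(2n) + a(2m) - 2 a(n + m), and past [N] all three moments lie within e/2
   of the infimum. *)
rewrite sqn_sub -!a_even iter_inner -/(a _ x).
by have := lb (n + m)%N; have := Nle n n Nn; have := Nle m m Nm; lra.
Qed.

Let iter_limit x : exists2 z, A z = z & forall e : R, 0 < e ->
  exists N, forall n, (N <= n)%N -> sqn (iter n A x - z) < e.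
Proof.
have [z zP] := sqn_complete (iter_cauchy x).
exists z => //; apply/eqP; rewrite -subr_eq0 -sqn_eq0; apply/eqP/lt_small_eq0.
  exact: sqn_ge0.
move=> e e0; have e4 : 0 < e / 4 by rewrite divr_gt0.
have [N hN] := zP _ e4.
have -> : A z - z = - A (iter N A x - z) + (iter N.+1 A x - z).
  by rewrite (linB lA) iterS opprB addrA subrK.
apply: le_lt_trans (sqn_parallelogram _ _) _; rewrite sqnN.
have := contraction_sqn (iter N A x - z).
by have := hN N (leqnn N); have := hN N.+1 (leqnSn N); lra.
Qed.

(* If no nonzero vector is fixed, [A^n] tends strongly to [0], hence so does
   its trace; but the trace of [A^n] dominates its norm, which is [1]. *)
Lemma fixed_vector B (M : R) : orthonormal_basis B ->
  (forall s, finsub B s -> \sum_(e <- s) qform A e <= M) ->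
  (forall d : R, 0 < d -> exists2 x, sqn x <= 1 & 1 - d < qform A x) ->
  exists2 z, z != 0 & A z = z.
Proof.
move=> bB AM A1; apply: contrapT => nofix.
have a0 x (e : R) : 0 < e -> exists N, forall n, (N <= n)%N -> a (n + n) x < e.
  move=> e0; have [z Az zP] := iter_limit x.
  have z0 : z = 0.
    by apply: contrapT => /eqP z0; apply: nofix; exists z.
  by have [N hN] := zP _ e0; exists N => n /hN; rewrite z0 subr0 a_even.
pose S := [set c : R | exists2 s, finsub B s & c = \sum_(e <- s) qform A e].
have supS : has_sup S.
  split; first by exists 0, [::]; rewrite ?big_nil.
  by exists M => _ [s fs ->]; exact: AM.
have d4 : 0 < 4^-1 :> R by rewrite invr_gt0.
have [_ [s0 fs0 ->] hs0] := sup_adherent d4 supS.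
have [N hN] : exists N, forall n, (N <= n)%N ->
    \sum_(e <- s0) a (n + n) e <= 4^-1.
  have [N hN] : exists N, forall n, (N <= n)%N -> forall e, e \in s0 ->
      a (n + n) e <= 4^-1 / (size s0).+1%:R.
    elim: (s0) (4^-1 / (size s0).+1%:R : R) (divr_gt0 d4 (ltr0Sn R (size s0)))
        => [|e s IHs] d d0.
      by exists 0%N.
    have [N1 h1] := IHs _ d0; have [N2 h2] := a0 e _ d0.
    exists (maxn N1 N2) => n; rewrite geq_max => /andP[n1 n2] f.
    by rewrite inE => /predU1P[->|/(h1 _ n1)//]; rewrite ltW// h2.
  exists N => n /hN {}hN; apply: (@le_trans _ _ (\sum_(e <- s0) 4^-1 / (size s0).+1%:R)).
    by rewrite !big_seq; apply: ler_sum => e /hN.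
  rewrite big_const_seq count_predT iter_addr addr0 -[X in X <= _]mulr_natr -mulrA.
  apply: ler_piMr; first exact: ltW.
  by rewrite ler_pdivrMl ?ltr0Sn// mulr1 ler_nat leqnSn.
(* The successor makes [n + n] positive, so that moments of order [n + n] are at most those of order
   1. *)
pose n := N.+1; have {}hN := hN n (leqnSn N).
(* At most 1/4 comes from [s0], by the choice of [N], and at most 1/4 from outside, where the sum is
   dominated by the tail of the trace of [A]. *)
have tr s : finsub B s -> \sum_(e <- s) qform (iter (n + n) A) e <= 2^-1.
  move=> fs; pose w := undup (s0 ++ s).
  have fw : finsub B w by exact: finsub_undup_cat.
  have Sw : \sum_(e <- w) a 1 e <= sup S.
    by apply: ub_le_sup; [case: supS|exists w].
  have sw : \sum_(e <- s) a (n + n) e <= \sum_(e <- w) a (n + n) e.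
    apply: ler_sum_sub; [by case: fs| |by move=> e _; exact: a_ge0].
    by move=> e es; rewrite mem_undup mem_cat es orbT.
  have s0w : \sum_(e <- s0) (a 1 e - a (n + n) e) <= \sum_(e <- w) (a 1 e - a (n + n) e).
    apply: ler_sum_sub; [by case: fs0| |].
      by move=> e es; rewrite mem_undup mem_cat es.
    by move=> e _; rewrite subr_ge0; apply: a_le; rewrite /n addSn.
  rewrite !sumrB in s0w; apply: le_trans sw _.
  move: hs0 hN Sw s0w; rewrite -[\sum_(e <- s0) qform A e]/(\sum_(e <- s0) a 1 e).
  move: (\sum_(e <- s0) a 1 e) (\sum_(e <- w) a 1 e) (sup S).
  move: (\sum_(e <- s0) a (n + n) e) (\sum_(e <- w) a (n + n) e).
  by move=> *; lra.
have pos : positive_op (iter (n + n) A).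
  by move=> x; rewrite -iter_inner; exact: dnorm_ge0.
have small x : a (n + n) x <= 2^-1 * sqn x.
  exact: (trace_bound (iter_linear (n + n)) pos bB tr).
(* Chosen so that (2n + 1) d = 1/4: a vector of the unit ball with form above 1 - d has moment of
   order 2n above 3/4, against the bound 1/2 from [small]. *)
pose d : R := (4 * (n + n).+1%:R)^-1.
have d0 : 0 < d by rewrite invr_gt0 mulr_gt0// ltr0Sn.
have [x x1 xd] := A1 _ d0.
have := a_lower (n + n) x; have := small x.
have -> : a 0%N x = sqn x by [].
rewrite -[qform A x]/(a 1%N x) in xd.
have dE : d * ((n + n)%:R + 1) = 4^-1.
  by rewrite natr1 /d invfM divfK// pnatr_eq0.
have := A_le1 x; rewrite -[qform A x]/(a 1%N x).
have := ler0n R (n + n).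
move: (n + n)%:R (a (n + n)%N x) (a 1%N x) (sqn x) x1 xd dE.
move=> m an a1 q x1 xd dE m0 a1q aq qa.
have : 0 <= m * (d - (q - a1)) by rewrite mulr_ge0//; lra.
lra.
Qed.

End Iterates.

(** The eigenvalue is the supremum of the form on the unit ball. Division by it brings [T] under
    [fixed_vector]; it is positive because [T x0] is nonzero. *)
Lemma eigenvector_exists (T : H -> H) B (M : R) (x0 : H) :
  linear T -> positive_op T -> orthonormal_basis B ->
  (forall s, finsub B s -> \sum_(e <- s) qform T e <= M) -> T x0 != 0 ->
  exists z (l : R), [/\ z != 0, 0 < l & T z = l%:C *: z].
Proof.
move=> lT pT bB TM Tx0.
pose S := [set qform T x | x in [set x | sqn x <= 1]].
have M0 : 0 <= M by have := TM [::]; rewrite big_nil; apply; split.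
have supS : has_sup S.
  split; first by exists (qform T 0), 0 => //=; rewrite sqn0.
  exists M => _ [x /= x1 <-]; apply: le_trans (trace_bound lT pT bB TM x) _.
  by rewrite ler_piMr.
have q0 : 0 < qform T x0.
  rewrite lt_neqAle eq_sym qform_ge0// andbT; apply: contra_neq Tx0 => q0.
  apply/eqP; rewrite -sqn_eq0 eq_le sqn_ge0 andbT.
  by have := trace_bound_sqn lT pT bB TM x0; rewrite q0 mulr0.
have qZ (c : R) x : qform T (c%:C *: x) = c ^+ 2 * qform T x.
  rewrite /qform (linZ lT) innerZl innerZr (qformE pT) /=; ring.
have nz x : x != 0 -> sqn ((Num.sqrt (sqn x))^-1%:C *: x) = 1.
  move=> x_neq0; rewrite sqnZ sqc_real exprVn sqr_sqrtr ?sqn_ge0// mulVf//.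
  by rewrite sqn_eq0.
have Sle x : qform T x <= sup S * sqn x.
  have [->|x_neq0] := eqVneq x 0; first by rewrite /qform (lin0 lT) inner0l sqn0 mulr0.
  have x_gt0 : 0 < sqn x by rewrite lt_neqAle sqn_ge0 eq_sym sqn_eq0 x_neq0.
  have : qform T ((Num.sqrt (sqn x))^-1%:C *: x) <= sup S.
    apply: ub_le_sup; first by case: supS.
    by exists ((Num.sqrt (sqn x))^-1%:C *: x) => //=; rewrite nz.
  by rewrite qZ exprVn sqr_sqrtr ?sqn_ge0// mulrC ler_pdivrMr.
have l0 : 0 < sup S.
  rewrite ltNge; apply/negP => Sle0; have := Sle x0; have := sqn_ge0 x0; nra.
pose A x := (sup S)^-1%:C *: T x.
have lA : linear A by move=> c u v; rewrite /A lT scalerDr !scalerA mulrC.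
have qA x : qform A x = (sup S)^-1 * qform T x.
  by rewrite /qform innerZl (qformE pT) /=; ring.
have pA : positive_op A.
  by move=> x; rewrite innerZl mulr_ge0// ler0c invr_ge0 ltW.
have A_le1 x : qform A x <= sqn x.
  by rewrite qA ler_pdivrMl.
have AM s : finsub B s -> \sum_(e <- s) qform A e <= (sup S)^-1 * M.
  move=> fs; under eq_bigr do rewrite qA.
  by rewrite -mulr_sumr ler_wpM2l ?TM// invr_ge0 ltW.
have [d d0|z z0 Az] := fixed_vector lA pA A_le1 bB AM.
  have [_ [x /= x1 <-] hx] := sup_adherent (mulr_gt0 d0 l0) supS.
  exists x => //; rewrite qA ltr_pdivlMl//; lra.
exists z, (sup S); split=> //; rewrite -[in RHS]Az /A scalerA -rmorphM.
by rewrite divff ?gt_eqF// scale1r.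
Qed.

End Eigenvector.

(** * Diagonalization *)

Section CoordOp.
Variables (R : realType) (H : hilbert R) (B : set H).
Hypothesis bB : orthonormal_basis B.
Implicit Types (x y z : H) (s : seq H) (w : H -> R).

(** Polarized Parseval: both inner products are sums of these coordinate products. The comparison is
    made on partial sums over one finite set good for both vectors, so no infinite sum in [R[i]]
    occurs. *)
Lemma parseval_inner_eq u v u' v' :
  (forall e, B e -> (inner v e)^*%C * inner u e = (inner v' e)^*%C * inner u' e) ->
  inner u v = inner u' v'.
Proof.
move=> uv; have /orthonormal_basisP[oB _] := bB.
apply/eqP; rewrite -subr_eq0 -sqc_eq0; apply/eqP/lt_small_eq0.
  exact: sqc_ge0.
move=> d d0; pose K := 2 * (sqn u + sqn u') + 1.
have K0 : 0 < K by rewrite /K; have := sqn_ge0 u; have := sqn_ge0 u'; lra.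
have [s fs hs] := parseval_approx v bB (divr_gt0 d0 K0).
have [s' fs' hs'] := parseval_approx v' bB (divr_gt0 d0 K0).
pose t := undup (s ++ s'); have ft : finsub B t by exact: finsub_undup_cat.
have refine (z : H) r : finsub B r -> (forall e, e \in r -> e \in t) ->
    sqn (z - lincomb r (inner z)) < d / K -> sqn (z - lincomb t (inner z)) < d / K.
  move=> fr rt; apply: le_lt_trans; rewrite (sqn_residual _ oB fr).
  rewrite (sqn_residual _ oB ft) lerD2l lerN2; apply: ler_sum_sub => //.
    by case: fr.
  by move=> e _; exact: sqc_ge0.
have {}hs : sqn (v - lincomb t (inner v)) < d / K.
  by apply: (refine _ s) => // e es; rewrite mem_undup mem_cat es.
have {refine hs'} hs' : sqn (v' - lincomb t (inner v')) < d / K.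
  by apply: (refine _ s') => // e es; rewrite mem_undup mem_cat es orbT.
set p := lincomb t _ in hs; set p' := lincomb t _ in hs'.
have pp' : inner u p = inner u' p'.
  rewrite !inner_lincomb_sum; apply: eq_big_seq => e et; apply: uv.
  by case: ft => _; exact.
have -> : inner u v - inner u' v' = inner u (v - p) + inner (- u') (v' - p').
  rewrite -[- u']sub0r innerBl inner0l !innerBr pp'; ring.
have h1 := sqc_add (inner u (v - p)) (inner (- u') (v' - p')).
have h2 := cauchy_schwarz u (v - p).
have h3 := cauchy_schwarz (- u') (v' - p'); rewrite sqnN in h3.
move: hs hs'; rewrite !ltr_pdivlMr// /K.
have := sqn_ge0 (v - p); have := sqn_ge0 (v' - p').
have := sqn_ge0 u; have := sqn_ge0 u'.
move: (sqn (v - p)) (sqn (v' - p')) (sqn u) (sqn u') h2 h3 => q q' a a'.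
by move=> *; nra.
Qed.

Lemma inner_disjoint u v :
  (forall e, B e -> inner u e = 0 \/ inner v e = 0) -> inner u v = 0.
Proof.
move=> h; rewrite -(inner0l v); apply: parseval_inner_eq => e Be.
by rewrite inner0l mulr0; case: (h e Be) => ->; rewrite ?mulr0// conjc0 mul0r.
Qed.

Section Bounded.
Variables (w : H -> R) (C : R).
Hypotheses (C0 : 0 <= C) (wC : forall e, B e -> w e ^+ 2 <= C).

Lemma coord_op_linear : linear (coord_op B w).
Proof.
have /orthonormal_basisP[_ tB] := bB.
move=> a u v; apply: (total_eq tB) => e Be.
rewrite innerDl innerZl !(coord_opP bB C0 wC _ Be) innerDl innerZl; ring.
Qed.

Lemma coord_op_selfadjoint x y :
  inner (coord_op B w x) y = inner x (coord_op B w y).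
Proof.
apply: parseval_inner_eq => e Be; rewrite !(coord_opP bB C0 wC _ Be).
by rewrite conjc_realM; ring.
Qed.

Lemma coord_op_sqn x : sqn (coord_op B w x) <= C * sqn x.
Proof.
rewrite -lee_fin -(parseval _ bB); apply: esum_fine_le => s fs.
have /orthonormal_basisP[oB _] := bB.
apply: (@le_trans _ _ (\sum_(e <- s) C * sqc (inner x e))).
  rewrite !big_seq; apply: ler_sum => e es; have Be : B e by case: fs => _; exact.
  by rewrite (coord_opP bB C0 wC _ Be) sqcM sqc_real ler_wpM2r ?sqc_ge0// wC.
by rewrite -mulr_sumr ler_wpM2l// (bessel_seq x oB).
Qed.

(** The form is the squared norm of the diagonal operator whose weights are the square roots. Their
    squares are bounded by [C + 1], whereas [w e <= C] can fail for [C < 1]. *)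
Lemma coord_op_positive : (forall e, B e -> 0 <= w e) ->
  positive_op (coord_op B w).
Proof.
move=> w0 x; have C1 : 0 <= C + 1 by rewrite addr_ge0.
have wC1 e : B e -> (Num.sqrt (w e)) ^+ 2 <= C + 1.
  move=> Be; rewrite sqr_sqrtr ?w0//; have := wC Be; have := w0 e Be; nra.
have -> : inner (coord_op B w x) x =
    inner (coord_op B (Num.sqrt \o w) x) (coord_op B (Num.sqrt \o w) x).
  apply: parseval_inner_eq => e Be; rewrite (coord_opP bB C0 wC _ Be).
  rewrite (coord_opP bB C1 wC1 _ Be) conjc_realM /=.
  rewrite -{1}(sqr_sqrtr (w0 e Be)) rmorphXn /= expr2; ring.
exact: dnorm_ge0.
Qed.

End Bounded.
End CoordOp.

Section Diagonalization.
Variables (R : realType) (H : hilbert R) (T : H -> H).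
Hypotheses (lT : linear T) (pT : positive_op T) (trT : (trace T < +oo)%E).
Implicit Types (x y z : H).

Lemma trace_fin : trace T = (fine (trace T))%:E.
Proof. by apply: esum_nneg_fine => // e _; exact: qform_ge0. Qed.

(** Take a maximal orthonormal set of eigenvectors and compress [T] to its orthogonal complement. An
    eigenvector of a nonzero compression would be one of [T], against maximality. So the compression
    is 0, the complement consists of eigenvectors for 0, and maximality makes it trivial. *)
Lemma eigenbasis : exists2 B : set H, orthonormal_basis B &
  forall e, B e -> T e = (qform T e)%:C *: e.
Proof.
pose P := [set x | exists l : R[i], T x = l *: x].
have [||//|B [_ BP oB maxB]] := @orthonormal_maximal _ _ P set0.
- move=> a x [l Tx]; exists l; rewrite (linZ lT) Tx !scalerA; congr (_ *: _).
  by rewrite mulrC.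
- by split.
have eig e : B e -> T e = (qform T e)%:C *: e.
  move=> Be; have [l Tl] := BP _ Be; rewrite Tl; congr (_ *: _).
  by rewrite -(qformE pT) Tl innerZl (oB.1 _ Be) mulr1.
have [B' BB' bB'] := orthonormal_extension oB.
have /orthonormal_basisP[oB' tB'] := bB'.
(* Weight 0 on [B] and 1 on the rest of a basis extending it: [Pr] projects onto the orthogonal
   complement of [B]. *)
pose w e : R := if `[< B e >] then 0 else 1.
have w1 e : B' e -> w e ^+ 2 <= 1.
  by move=> _; rewrite /w; case: asboolP => _; rewrite ?expr0n ?expr1n.
pose Pr := coord_op B' w; have PrE := coord_opP bB' ler01 w1.
have PrB x e : B e -> inner (Pr x) e = 0.
  by move=> Be; rewrite PrE ?/w; [case: asboolP; rewrite // mul0r|exact: BB'].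
have Pr_id x : (forall e, B e -> inner x e = 0) -> Pr x = x.
  move=> xB; apply: (total_eq tB') => e B'e; rewrite PrE// /w.
  by case: asboolP => [Be|_]; [rewrite xB// mulr0|rewrite mul1r].
have TB x e : (forall e, B e -> inner x e = 0) -> B e -> inner (T x) e = 0.
  move=> xB Be; rewrite (positive_selfadjoint lT pT) eig// innerZr xB//.
  by rewrite mulr0.
have lPr : linear Pr := coord_op_linear bB' ler01 w1.
have saPr := coord_op_selfadjoint bB' ler01 w1.
pose S x := Pr (T (Pr x)).
have qS x : inner (S x) x = inner (T (Pr x)) (Pr x) by rewrite saPr.
have S0 x : S x = 0.
  apply: contrapT => /eqP Sx.
  have lS : linear S by move=> a u v; rewrite /S lPr lT lPr.
  have pS : positive_op S by move=> u; rewrite qS; exact: pT.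
  (* [T] preserves the complement of [B], so the cross terms vanish and the form of [T] dominates
     that of the compression. *)
  have trS s : finsub (@hilbert_basis R H) s ->
      \sum_(e <- s) qform S e <= fine (trace T).
    move=> fs; apply: (@le_trans _ _ (\sum_(e <- s) qform T e)); last first.
      by rewrite -lee_fin -trace_fin; exact: esum_ge_finsub fs.
    apply: ler_sum => u _; pose v := u - Pr u.
    have cross : inner (T (Pr u)) v = 0.
      apply: (inner_disjoint bB') => e B'e; rewrite /v innerBl PrE// /w.
      case: asboolP => [Be|_]; last by right; rewrite mul1r subrr.
      by left; apply: TB => // f; exact: PrB.
    have uE : u = Pr u + v by rewrite /v addrC subrK.
    clearbody v.
    have -> : qform T u = qform S u + qform T v.
      have cross' : inner (T v) (Pr u) = 0.
        by rewrite (positive_selfadjoint lT pT) innerC cross conjc0.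
      have -> : qform T u = complex.Re (inner (T (Pr u + v)) (Pr u + v)).
        by rewrite -uE.
      rewrite (linD lT) innerDl !innerDr cross cross' addr0 add0r.
      by rewrite /qform qS raddfD.
    by rewrite lerDl qform_ge0.
  have [z [l [z0 l0 Sz]]] := eigenvector_exists lS pS (hilbert_basisP H) trS Sx.
  have Prz : Pr z = z.
    apply: Pr_id => e Be; have : inner (S z) e = 0 by exact: PrB.
    rewrite Sz innerZl => /eqP; rewrite mulf_eq0 => /orP[|/eqP//].
    by rewrite eq_complex /= gt_eqF.
  have zB e : B e -> inner z e = 0 by rewrite -Prz; exact: PrB.
  have Tz : T z = l%:C *: z.
    by rewrite -Sz /S Prz Pr_id// => e; exact: TB.
  by move/eqP: z0; apply; apply: maxB => //; exists l%:C.
exists B => //; apply/orthonormal_basisP; split=> // x xB.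
apply: maxB => //; exists 0; rewrite scale0r -(S0 x) /S (Pr_id x xB) Pr_id//.
by move=> e; exact: TB.
Qed.

End Diagonalization.

(** * Existence of the spectral measure *)

(** Distinct vectors of [B] are at squared distance 2, so points of the dense set chosen at squared
    distance below 1/4 from them are distinct. *)
Lemma orthonormal_countable (R : realType) (H : hilbert R) (B : set H) :
  separable H -> orthonormal_set B -> countable B.
Proof.
move=> [D [cD dD]] oB.
have /choice[f fP] : forall e, exists d, D d /\ sqn (d - e) < 4^-1.
  move=> e; have := dD (ball e (2^-1 : R)%:C).
  have e2 : 0 < (2^-1 : R)%:C by rewrite ltcR invr_gt0.
  have [||d [Bd Dd]] := dD (ball e (2^-1 : R)%:C).
  - by exists e; exact: ballxx.
  - exact: ball_open.
  move=> _; exists d; split=> //.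
  have := Bd; rewrite -ball_normE /= norm_lt ?invr_gt0// -sqnN opprB.
  by rewrite exprVn -natrX.
have finj : {in B &, injective f}.
  move=> e e' /set_mem Be /set_mem Be' ff; apply: contrapT => /eqP ee'.
  have := sqn_parallelogram (e - f e) (f e - e'); rewrite addrA subrK.
  have [_ h] := fP e; have [_ h'] := fP e'; rewrite -ff in h'.
  rewrite (sqn_sub e e') (oB.2 _ _ Be Be' ee') /= mulr0 subr0.
  have -> : sqn e = 1 by rewrite /sqn oB.1.
  have -> : sqn e' = 1 by rewrite /sqn oB.1.
  by move: h; rewrite -sqnN opprB; lra.
have : countable (f @` B).
  by apply: sub_countable cD; apply: subset_card_le => _ [e _ <-]; case: (fP e).
by rewrite /countable (card_le_eql (inj_card_eq finj)).
Qed.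

(** The sum of masses [w e] at the points [l e]. Specifying integrals serves both requirements on a
    scalar measure: indicators give its values on sets, the positive and negative parts of t its
    first moment. *)
Lemma discrete_measure (R : realType) (T : choiceType) (B : set T) (w l : T -> R) :
  countable B -> (forall e, B e -> 0 <= w e) ->
  exists mu : {measure set (measurableTypeR R) -> \bar R},
  forall g : R -> \bar R, (forall t, (0 <= g t)%E) ->
    measurable_fun [set: measurableTypeR R] g ->
    (\int[mu]_(t in [set: measurableTypeR R]) g t)%E =
    \esum_(e in B) ((w e)%:E * g (l e))%E.
Proof.
move=> /countable_injP[f finj] w0.
have [->|/set0P[e0 Be0]] := eqVneq B set0.
  exists mzero => g g0 mg; rewrite esum_set0.
  by rewrite integral_measure_zero.
(* [h] inverts the injection [f] of [B] into the naturals; indices outside its image go to some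
   element of [B] and get mass 0 below. *)
have /choice[h hP] : forall n, exists e, B e /\ ((f @` B) n -> f e = n).
  move=> n; have [[e Be <-]|nB] := pselect ((f @` B) n); first by exists e.
  by exists e0.
have hf e : B e -> h (f e) = e.
  move=> Be; have [Bh /(_ (ex_intro2 _ _ e Be erefl))] := hP (f e).
  by move=> /finj; apply; exact/mem_set.
have c0 n : 0 <= w (h n) * (n \in f @` B)%:R.
  by rewrite mulr_ge0// w0//; case: (hP n).
pose m n : {measure set (measurableTypeR R) -> \bar R} :=
  mscale (NngNum (c0 n)) (dirac (l (h n) : measurableTypeR R)).
exists (mseries m 0) => g g0 mg; rewrite ge0_integral_measure_series//.
transitivity (\big[+%E/0%E]_(0 <= n <oo)
    ((w (h n) * (n \in f @` B)%:R)%:E * g (l (h n)))%E).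
  apply: eq_eseriesr => n _; rewrite ge0_integral_mscale//.
  by rewrite integral_dirac// diracT mul1e.
rewrite nneseries_esumT; last by move=> n; rewrite mule_ge0// lee_fin.
transitivity (\esum_(n in f @` B) ((w (h n))%:E * g (l (h n)))%E).
  rewrite [RHS]esum_mkcond; apply: eq_esum => n _.
  by case: ifPn => _; rewrite ?mulr1// mulr0 mul0e.
rewrite esum_image; last by move=> e e' Be Be'; exact: finj.
by apply: eq_esum => e Be; rewrite hf.
Qed.

Section SpectralExistence.
Variables (R : realType) (H : hilbert R) (S : H -> H) (B : set H).
Hypotheses (lS : linear S) (pS : positive_op S).
Hypotheses (sepH : separable H) (bB : orthonormal_basis B).
Hypothesis eigB : forall e, B e -> S e = (qform S e)%:C *: e.
Hypothesis S_le1 : forall x, qform S x <= sqn x.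

Let E (A : set R) : H -> H := coord_op B (fun e => \1_A (qform S e)).

Let indic1 (A : set R) e : B e -> (\1_A (qform S e) : R) ^+ 2 <= 1.
Proof. by move=> _; rewrite indicE; case: (_ \in _); rewrite ?expr0n ?expr1n. Qed.

Let EE A x e : B e -> inner (E A x) e = (\1_A (qform S e))%:C * inner x e.
Proof. by move=> Be; rewrite /E (coord_opP bB ler01 (@indic1 A) _ Be). Qed.

Lemma inner_eigenbasis x e : B e -> inner (S x) e = (qform S e)%:C * inner x e.
Proof.
by move=> Be; rewrite (positive_selfadjoint lS pS) eigB// innerZr [(_%:C)^*%C]conjc_real.
Qed.

Lemma qform_eigenbasis x :
  (qform S x)%:E = \esum_(e in B) (sqc (inner x e) * qform S e)%:E.
Proof.
have q0 e : 0 <= qform S e by exact: qform_ge0.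
have /orthonormal_basisP[[B1 _] _] := bB.
have w1 e : B e -> Num.sqrt (qform S e) ^+ 2 <= 1.
  by move=> Be; rewrite sqr_sqrtr// (le_trans (S_le1 e))// /sqn B1.
have DE := coord_opP bB ler01 w1.
(* Parseval computes squared norms, so the form is written as the squared norm of a diagonal square
   root. *)
pose D := coord_op B (fun e => Num.sqrt (qform S e)).
have -> : qform S x = sqn (D x).
  rewrite /qform /sqn; congr complex.Re; apply: (parseval_inner_eq bB) => e Be.
  rewrite inner_eigenbasis// /D DE// conjc_realM mulrACA -rmorphM -expr2.
  by rewrite sqr_sqrtr//; ring.
rewrite -(parseval _ bB); apply: eq_esum => e Be.
by rewrite DE// sqcM sqc_real sqr_sqrtr// mulrC.
Qed.

Lemma spectral_measure_exists : exists E, is_spectral_measure S E.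
Proof.
have /orthonormal_basisP[oB tB] := bB.
exists E; split.
- by move=> A _; exact: (coord_op_linear bB ler01 (indic1 A)).
- by move=> A _; rewrite /E; exact: (coord_op_selfadjoint bB ler01 (indic1 A)).
- by move=> x; apply: (total_eq tB) => e Be; rewrite EE// indicT mul1r.
- move=> A A' _ _ x; apply: (total_eq tB) => e Be; rewrite !EE// indicI mulrA.
  by rewrite -rmorphM.
move=> x; have cB := orthonormal_countable sepH oB.
have [mu muP] := @discrete_measure R H B (fun e => sqc (inner x e)) (qform S) cB
  (fun e _ => sqc_ge0 (inner x e)).
have q0 e : 0 <= qform S e by exact: qform_ge0.
have mid : measurable_fun [set: measurableTypeR R]
    (fun t : measurableTypeR R => (t : R)%:E).
  exact: EFin_measurable.
(* Eigenvalues are nonnegative, so only the values of [g] on nonnegative reals count; this serves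
   for |t| and for the positive part of t. *)
have int1 (g : R -> \bar R) : (forall t, (0 <= g t)%E) ->
   (forall t, 0 <= t -> g t = t%:E) ->
   measurable_fun [set: measurableTypeR R] g ->
   (\int[mu]_(t in [set: measurableTypeR R]) g t)%E = (qform S x)%:E.
  move=> g0 gt mg; rewrite muP// qform_eigenbasis; apply: eq_esum => e _.
  by rewrite gt.
exists mu; split.
- move=> A mA.
  have := muP (fun t => (\1_A t)%:E) (fun t => _).
  rewrite integral_indic// setIT => ->; last 2 first.
  + by move=> t; rewrite lee_fin.
  + by apply/measurable_EFinP; exact: measurable_indic.
  have -> : inner (E A x) x = inner (E A x) (E A x).
    rewrite -(coord_op_selfadjoint bB ler01 (indic1 A)); congr (inner _ _).
    apply: (total_eq tB) => e Be; rewrite !EE// mulrA -rmorphM indicE.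
    by case: (_ \in _); rewrite ?mulr0 ?mulr1.
  rewrite -[complex.Re _]/(sqn _) -(parseval _ bB); apply: eq_esum => e Be.
  rewrite EE// sqcM sqc_real mulrC -EFinM indicE.
  by case: (_ \in _); rewrite ?expr0n ?expr1n.
- apply/integrableP; split => //.
  rewrite (int1 (fun t => `|t%:E|)%E) ?ltry//.
  + by move=> t t0; rewrite gee0_abs.
  + exact: measurableT_comp.
- rewrite (qformE pS); congr (_%:C); rewrite /Rintegral integralE.
  rewrite (int1 (EFin^\+)%E); last 3 first.
  + by move=> t; exact: funepos_ge0.
  + by move=> t t0; rewrite funeposE max_l// lee_fin.
  + exact: measurable_funepos.
  rewrite muP; last 2 first.
  + by move=> t; exact: funeneg_ge0.
  + exact: measurable_funeneg.
  rewrite esum1 ?sube0// => e _.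
  by rewrite funenegE max_r ?mule0// -EFinN lee_fin oppr_le0.
Qed.

End SpectralExistence.

(** * Spectral projections of eigenvectors *)

Section SpectralEigenvector.
Variables (R : realType) (H : hilbert R) (S : H -> H) (E : set R -> H -> H).
Hypotheses (lS : linear S) (pS : positive_op S).
Hypothesis hE : is_spectral_measure S E.
Implicit Types (x y z p q : H) (A B : set (measurableTypeR R)).

Let lE A (mA : measurable A) : linear (E A). Proof. exact: (spectral_linear hE mA). Qed.

Let E_idem A x : measurable A -> E A (E A x) = E A x.
Proof. by move=> mA; rewrite -(spectral_setI hE)// setIid. Qed.

Let E_inner A x : measurable A -> inner (E A x) x = inner (E A x) (E A x).
Proof.
by move=> mA; rewrite -[RHS](spectral_selfadjoint hE)// E_idem.
Qed.

Lemma spectral_scalar_measure x :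
  exists mu : {measure set (measurableTypeR R) -> \bar R},
    [/\ forall A, measurable A -> mu A = (sqn (E A x))%:E,
        mu.-integrable setT (fun t => t%:E) &
        (\int[mu]_t t%:E)%E = (qform S x)%:E].
Proof.
have [mu [muE imu Smu]] := spectral_integral hE x.
exists mu; split=> // [A mA|]; first by rewrite muE// E_inner.
rewrite -[LHS]fineK; first by rewrite /qform Smu.
exact: integrable_fin_num.
Qed.

Let E0 x : E set0 x = 0.
Proof.
have [mu [muE _ _]] := spectral_scalar_measure x.
apply/eqP; rewrite -sqn_eq0 -(inj_eq (@EFin_inj R)) -muE//.
by rewrite measure0.
Qed.

Let E_disjoint A B x : measurable A -> measurable B -> A `&` B = set0 ->
  E A (E B x) = 0.
Proof. by move=> mA mB AB; rewrite -(spectral_setI hE)// AB E0. Qed.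

(** Additivity is only available through scalar measures: the difference [z] is killed by the
    projections of [A] and of its complement, so its scalar measure has mass 0. *)
Let E_setC A x : measurable A -> E A x + E (~` A) x = x.
Proof.
move=> mA; have mAC := measurableC mA.
pose z := x - (E A x + E (~` A) x).
have zA : E A z = 0.
  rewrite /z (linB (lE mA)) (linD (lE mA)) E_idem// E_disjoint// ?addr0 ?subrr//.
  exact: setICr.
have zAC : E (~` A) z = 0.
  rewrite /z (linB (lE mAC)) (linD (lE mAC)) E_idem// E_disjoint// ?add0r ?subrr//.
  exact: setICl.
have [mu [muE _ _]] := spectral_scalar_measure z.
have : mu setT = 0%E.
  have : (mu (A `|` ~` A) = mu A + mu (~` A))%E by rewrite measureU// setICr.
  by rewrite setUv !muE// zA zAC sqn0 adde0.
rewrite muE// (spectral_setT hE) => -[/eqP]; rewrite sqn_eq0 subr_eq0.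
by move/eqP.
Qed.

Let qform_eq x y : (forall A, measurable A -> sqn (E A x) = sqn (E A y)) ->
  qform S x = qform S y.
Proof.
move=> xy; have [mu [muE _ muS]] := spectral_scalar_measure x.
have [nu [nuE _ nuS]] := spectral_scalar_measure y.
apply: EFin_inj; rewrite -muS -nuS; apply: eq_measure_integral => A mA _.
by rewrite muE// nuE// xy.
Qed.

(* The scalar measure of [p + u *: q] does not depend on the phase [u] when
   [p] and [q] lie in complementary spectral subspaces. *)
Let E_offdiag A p q : measurable A -> E A p = p -> E (~` A) q = q ->
  inner (S p) q = 0.
Proof.
move=> mA Ap Aq; have mAC := measurableC mA.
have phase u : sqc u = 1 -> qform S (p + u *: q) = qform S (p + q).
  move=> u1; apply: qform_eq => B mB.
  have cross : inner (E B p) (E B q) = 0.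
    rewrite (spectral_selfadjoint hE)// E_idem// -Ap (spectral_selfadjoint hE)//.
    rewrite -Aq -(spectral_setI hE)// E_disjoint ?inner0r//; first exact: measurableI.
    by apply/seteqP; split=> // t /=; tauto.
  rewrite !(linD (lE mB)) (linZ (lE mB)) !sqn_add sqnZ u1 mul1r innerZr cross.
  by rewrite mulr0.
have qE u : qform S (p + u *: q) =
    complex.Re (inner (S p) p + u * u^*%C * inner (S q) q +
    (u^*%C * inner (S p) q + u * (inner (S p) q)^*%C)).
  rewrite /qform (linD lS) (linZ lS) innerDl !innerDr !innerZl !innerZr.
  have -> : inner (S q) p = (inner (S p) q)^*%C.
    by rewrite (positive_selfadjoint lS pS) -innerC.
  by congr complex.Re; ring.
have h1 : sqc (1 : R[i]) = 1 by rewrite /sqc /=; ring.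
have h2 : sqc (-1 : R[i]) = 1 by rewrite /sqc /=; ring.
have h3 : sqc ('i : R[i]) = 1 by rewrite /sqc /=; ring.
have h4 : sqc (- 'i : R[i]) = 1 by rewrite /sqc /=; ring.
(* The phases 1 and -1 kill the real part of <S p, q>, the phases i and -i its imaginary part. *)
have := phase _ h1; have := phase _ h2; have := phase _ h3; have := phase _ h4.
rewrite !qE; move: (qform S (p + q)) => m.
case: (inner (S p) q) => a b; case: (inner (S p) p) => ? ?.
case: (inner (S q) q) => ? ? /= *.
by apply/eqP; rewrite eq_complex /=; apply/andP; split; apply/eqP; lra.
Qed.

Let E_invariant A p : measurable A -> E A p = p -> E A (S p) = S p.
Proof.
move=> mA Ap; have mAC := measurableC mA.
have := E_setC (S p) mA; set r := E (~` A) _.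
suff -> : r = 0 by rewrite addr0.
apply/eqP; rewrite -sqn_eq0 /sqn /r -E_inner// (spectral_selfadjoint hE)//.
by rewrite (E_offdiag mA Ap) ?E_idem.
Qed.

(** [spectral_integral] speaks of <S x, x> only. Commutation follows from the invariance under [S]
    of the ranges of the two complementary projections. *)
Lemma spectral_commute A x : measurable A -> S (E A x) = E A (S x).
Proof.
move=> mA; have mAC := measurableC mA.
rewrite -[in RHS](E_setC x mA) (linD lS) (linD (lE mA)).
rewrite (E_invariant mA) ?E_idem// -[S (E (~` A) x)](E_invariant mAC) ?E_idem//.
by rewrite E_disjoint ?addr0// setICr.
Qed.

(** [E A y] is again in the eigenspace of [l], with scalar measure carried by [A]. The integral of t
    - l vanishes while t - l has a strict sign on [A], so the measure is 0. The sign [s] treats both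
    half-lines at once. *)
Let E_one_side (l s : R) A y : s ^+ 2 = 1 -> measurable A ->
  (forall t, A t -> 0 < s * (t - l)) -> S y = l%:C *: y -> E A y = 0.
Proof.
move=> s1 mA As Sy; have mAC := measurableC mA.
pose x := E A y; rewrite -/x.
have Sx : S x = l%:C *: x by rewrite /x spectral_commute// Sy (linZ (lE mA)).
have [mu [muE imu muS]] := spectral_scalar_measure x.
have muT : mu setT = (sqn x)%:E by rewrite muE// (spectral_setT hE).
have muAC : mu (~` A) = 0%E.
  by rewrite muE// /x E_disjoint ?sqn0// setICl.
have il : mu.-integrable setT (EFin \o cst l).
  rewrite (_ : EFin \o cst l = cst l%:E)//.
  apply/integrableP; split; first exact: measurable_cst.
  rewrite (_ : (fun t => _) = cst `|l%:E|%E)// integral_cst// muT.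
  by rewrite -EFinM ltry.
have ig : mu.-integrable setT (fun t => (t%:E - l%:E)%E).
  exact: integrableB.
have il0 : (\int[mu]_t cst l%:E t)%E = (l * sqn x)%:E.
  by rewrite integral_cst// muT EFinM.
have g0 : (\int[mu]_t (t%:E - l%:E))%E = 0%E.
  rewrite (integralB_EFin measurableT imu il) muS.
  rewrite [X in (_ - X)%E](_ : _ = (l * sqn x)%:E); last exact: il0.
  have -> : qform S x = l * sqn x by rewrite /qform Sx innerZl sqnE /=; ring.
  by rewrite subee.
have gA : (\int[mu]_(t in A) (t%:E - l%:E))%E = 0%E.
  rewrite -g0 (negligible_integral mAC measurableT ig muAC).
  by rewrite setTD setCK.
have absA : (\int[mu]_(t in A) `|t%:E - l%:E|)%E = 0%E.
  have iA := integrableS measurableT mA (@subsetT _ A) ig.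
  have <- : (s%:E * \int[mu]_(t in A) (t%:E - l%:E) = 0)%E by rewrite gA mule0.
  rewrite -integralZl//; apply: eq_integral => t /set_mem /As h.
  rewrite -EFinB -EFinM abse_EFin; congr EFin.
  rewrite -[RHS]ger0_norm ?ltW// normrM.
  have -> : `|s| = 1.
    by apply/eqP; rewrite -(@eqrXn2 _ 2)// ?expr1n -?normrX ?s1 ?normr1.
  by rewrite mul1r.
have mg : measurable_fun A (fun t : measurableTypeR R => ((t : R)%:E - l%:E)%E).
  apply: (measurable_int mu).
  exact: integrableS measurableT mA (@subsetT _ A) ig.
have /(ae_eq_integral_abs mu mA mg) [N [mN N0 sN]] := absA.
have AN : A `<=` N.
  move=> t At; apply: sN => /= /(_ At); rewrite -EFinB => -[h].
  by have := As t At; rewrite h mulr0 ltxx.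
have muA : mu A = 0%E by exact: (subset_measure0 mA mN AN N0).
have : mu setT = 0%E.
  have : (mu (A `|` ~` A) = mu A + mu (~` A))%E by rewrite measureU// setICr.
  by rewrite setUv muA muAC adde0.
by rewrite muT => -[/eqP]; rewrite sqn_eq0 => /eqP.
Qed.

(** The projections of both open half-lines at [l] kill [e], so that of the singleton fixes it, and
    everything depends on whether [A] meets the singleton. *)
Lemma spectral_eigenvector A (l : R) e : measurable A -> S e = l%:C *: e ->
  E A e = (\1_A l)%:C *: e.
Proof.
move=> mA Se.
pose Agt : set R := `]l, +oo[%classic; pose Alt : set R := `]-oo, l[%classic.
have mgt : measurable Agt by exact: measurable_itv.
have mlt : measurable Alt by exact: measurable_itv.
have m1 : measurable ([set l] : set (measurableTypeR R)) by exact: measurable_set1.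
have Egt : E Agt e = 0.
  apply: (@E_one_side l 1) => //; first by rewrite expr1n.
  by move=> t; rewrite /Agt /Alt /= in_itv /= andbT mul1r subr_gt0.
have Elt : E Alt e = 0.
  apply: (@E_one_side l (-1)) => //; first by rewrite sqrrN expr1n.
  by move=> t; rewrite /Agt /Alt /= in_itv /= mulN1r oppr_gt0 subr_lt0.
have E1C : E (~` [set l]) e = 0.
  have -> : ~` [set l] = ~` [set l] `&` (Agt `|` Alt) :> set R.
    apply/seteqP; split=> [t /= /eqP tl|t [] //]; split; first exact/eqP.
    by move: tl; rewrite /Agt /Alt /= !in_itv /= andbT neq_lt => /orP[->|->]; [right|left].
  rewrite (spectral_setI hE)//; [|exact: measurableC|exact: measurableU].
  have -> : E (Agt `|` Alt) e = 0; last exact: lin0 (lE (measurableC m1)).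
  rewrite -(E_setC (E _ _) mgt) -!(spectral_setI hE)//; last 3 first.
  - exact: measurableC.
  - exact: measurableU.
  - exact: measurableU.
  have -> : Agt `&` (Agt `|` Alt) = Agt :> set R.
    by apply: setIidl => t; left.
  have -> : ~` Agt `&` (Agt `|` Alt) = Alt :> set R.
    apply/seteqP; split=> [t [] /=|t /=]; rewrite /Agt /Alt /= !in_itv /= andbT.
      by move=> h [].
    by move=> tl; split; [apply/negP; rewrite -leNgt ltW|right].
  by rewrite Egt Elt addr0.
have E1 : E [set l] e = e by have := E_setC e m1; rewrite E1C addr0.
rewrite -[in LHS]E1 -(spectral_setI hE)// indicE; have [Al|nAl] := boolP (l \in A).
  rewrite scale1r (_ : A `&` _ = [set l])//.
  by apply/seteqP; split=> [t []//|t ->]; split=> //; exact/set_mem.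
rewrite scale0r (_ : A `&` _ = set0) ?E0//.
apply/seteqP; split=> // t [At /= tl]; move: nAl; rewrite -tl => /negP; apply.
exact/mem_set.
Qed.

End SpectralEigenvector.

(** * Ranks *)

Section Rank.
Variables (R : realType) (H : hilbert R).
Implicit Types (B D : set H) (s t : seq H).

Lemma lincomb_ord s (c : H -> R[i]) :
  lincomb s c = \sum_(j < size s) c s`_j *: s`_j.
Proof. by rewrite /lincomb (big_nth 0) big_mkord. Qed.

Lemma rank_ge (G : hilbert R) (T : H -> G) n (x : 'I_n -> H) :
  (forall c : 'I_n -> R[i], \sum_(i < n) c i *: T (x i) = 0 -> forall i, c i = 0) ->
  (n%:R%:E <= rank T)%E.
Proof. by move=> h; apply: ereal_sup_ubound; exists n => //=; exists x. Qed.

Lemma rank_coordinate_projection (P : H -> H) B s : orthonormal_basis B -> finsub B s ->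
  (forall x e, B e -> inner (P x) e = if e \in s then inner x e else 0) ->
  rank P = (size s)%:R%:E.
Proof.
move=> bB fs PE; have /orthonormal_basisP[oB tB] := bB.
have sB j : (j < size s)%N -> B s`_j.
  by move=> js; case: fs => _; apply; rewrite mem_nth.
have PL x : P x = lincomb s (inner x).
  by apply: (total_eq tB) => e Be; rewrite PE// (inner_lincomb_seq _ oB fs Be).
apply/eqP; rewrite eq_le; apply/andP; split; last first.
  apply: (@rank_ge _ _ _ (fun j : 'I_(size s) => s`_j)) => c.
  have Ps (j : 'I_(size s)) : P s`_j = s`_j.
    apply: (total_eq tB) => e Be; rewrite PE//; case: ifPn => // es.
    rewrite (orthonormal_inner oB)//; last exact: sB.
    by case: eqP => // se; rewrite -se mem_nth in es.
  move=> c0 i; have := congr1 (fun y => inner y s`_i) c0.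
  rewrite inner0l inner_suml (bigD1 i)//= big1 ?addr0.
    by rewrite Ps innerZl oB.1 ?mulr1//; exact: sB.
  move=> j ji; rewrite Ps innerZl oB.2 ?mulr0//; [exact: sB|exact: sB|].
  by rewrite nth_uniq//; case: fs.
apply: ge_ereal_sup => _ [n [x xind] <-]; rewrite lee_fin ler_nat.
pose M := \matrix_(i < n, j < size s) inner (x i) s`_j.
suff : row_free M by rewrite /row_free => /eqP <-; exact: rank_leq_col.
apply: inj_row_free => v vM; apply/rowP => i; rewrite mxE.
apply: (xind (fun i => v 0 i)).
under eq_bigr do rewrite PL lincomb_ord scaler_sumr.
rewrite exchange_big big1//= => j _.
under eq_bigr do rewrite scalerA.
rewrite -scaler_suml.
have -> : \sum_(l < n) v 0 l * inner (x l) s`_j = (v *m M) 0 j.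
  by rewrite mxE; apply: eq_bigr => l _; rewrite mxE.
by rewrite vM mxE scale0r.
Qed.

(* Schmidt orthonormalization of the kernel of the Gram matrix of [T] on [s]. *)
Lemma kernel_orthonormal (G : hilbert R) (T : H -> G) B s (N : nat) :
  linear T -> orthonormal_set B -> finsub B s -> (rank T <= N%:R%:E)%E ->
  exists t D, [/\ orthonormal_set D, finsub D t, (size s <= N + size t)%N &
    forall v, v \in t -> T v = 0 /\ v = lincomb s (inner v)].
Proof.
move=> lT oB fs rT; set k := size s.
have sB j : (j < k)%N -> B s`_j.
  by move=> js; case: fs => _; apply; rewrite mem_nth.
pose A := \matrix_(i < k, j < k) inner (T s`_i) (T s`_j).
pose w (v : 'rV[R[i]]_k) : H := \sum_(j < k) v 0 j *: s`_j.
have vA (v : 'rV[R[i]]_k) j : (v *m A) 0 j = inner (T (w v)) (T s`_j).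
  rewrite /w (lin_sum lT) inner_suml mxE; apply: eq_bigr => i _.
  by rewrite mxE (linZ lT) innerZl.
(* Independent rows of the Gram matrix come from vectors of [s] with independent images under
   [T]. *)
have rA : (\rank A <= N)%N.
  rewrite -(ler_nat R) -lee_fin; apply: le_trans rT.
  apply: (@rank_ge _ _ _ (fun i => s`_(maxrankfun A i))) => c c0.
  have rf : row_free (rowsub (maxrankfun A) A) := maxrowsub_free A.
  have c0' : \row_i c i *m rowsub (maxrankfun A) A = 0.
    apply/rowP => j; rewrite !mxE.
    transitivity (inner (\sum_(i < \rank A) c i *: T s`_(maxrankfun A i)) (T s`_j)).
      by rewrite inner_suml; apply: eq_bigr => i _; rewrite !mxE innerZl.
    by rewrite c0 inner0l.
  move=> i; have /eqP := c0'; rewrite mulmx_free_eq0// => /eqP/rowP/(_ i).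
  by rewrite !mxE.
pose K := row_base (kermx A); pose U := schmidt K.
have Uu : U \is unitarymx by apply: schmidt_unitarymx; exact: rank_leq_col.
have UA : U *m A = 0.
  apply/sub_kermxP; rewrite (eqmx_schmidt_free (row_base_free _)).
  by rewrite eq_row_base.
set r := \rank (kermx A) in K U Uu UA *.
pose v (a : 'I_r) : H := w (row a U).
have vv a b : inner (v a) (v b) = (a == b)%:R.
  have /unitarymxP/matrixP/(_ a b) := Uu; rewrite !mxE => <-.
  rewrite /v /w inner_suml; apply: eq_bigr => j _.
  rewrite innerZl inner_sumr (bigD1 j)//= big1 ?addr0.
    by rewrite innerZr oB.1 ?mulr1 ?mxE//; exact: sB.
  move=> i ij; rewrite innerZr oB.2 ?mulr0//; [exact: sB|exact: sB|].
  by rewrite nth_uniq 1?eq_sym//; case: fs.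
have vinj : injective v.
  move=> a b vab; have := vv a b; rewrite -vab vv eqxx.
  by case: eqP => // _ /eqP; rewrite oner_eq0.
exists [seq v a | a : 'I_r], [set v a | a in [set: 'I_r]]; split.
- split=> [_ [a _ <-]|_ _ [a _ <-] [b _ <-]]; first by rewrite vv eqxx.
  by move=> vab; rewrite vv; case: (eqVneq a b) vab => [->|//]; rewrite eqxx.
- split; first by rewrite map_inj_uniq ?enum_uniq.
  by move=> _ /mapP[a _ ->]; exists a.
- rewrite size_map size_enum_ord /r mxrank_ker -/k.
  by rewrite -leq_subLR leq_sub2l.
move=> _ /mapP[a _ ->]; split.
  (* For a kernel vector of the Gram matrix, [T (v a)] is orthogonal to the image of every vector of
     [s], hence to itself. *)
  have key j : inner (T (v a)) (T s`_(j : 'I_k)) = 0.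
    by rewrite /v -vA -row_mul UA !mxE.
  have vE : v a = \sum_(j < k) row a U 0 j *: s`_j by [].
  have perp y : (forall j : 'I_k, inner y (T s`_j) = 0) -> inner y (T (v a)) = 0.
    move=> yT; rewrite vE (lin_sum lT) inner_sumr big1//= => j _.
    by rewrite (linZ lT) innerZr yT mulr0.
  by apply/eqP; rewrite -sqn_eq0 /sqn perp.
rewrite lincomb_ord; apply: eq_bigr => j _; congr (_ *: _).
rewrite /v /w inner_suml (bigD1 j)//= big1 ?addr0.
  by rewrite innerZl oB.1 ?mulr1//; exact: sB.
move=> i ij; rewrite innerZl oB.2 ?mulr0//; [exact: sB|exact: sB|].
by rewrite nth_uniq//; case: fs.
Qed.

End Rank.

(** * Counting eigenvalues *)

Lemma trace_eigenbasis (R : realType) (H : hilbert R) (T : H -> H) (B : set H) :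
  linear T -> positive_op T -> (forall x, qform T x <= sqn x) ->
  orthonormal_basis B -> (forall e, B e -> T e = (qform T e)%:C *: e) ->
  trace T = \esum_(e in B) (qform T e)%:E.
Proof.
move=> lT pT T1 bB eigB; have /orthonormal_basisP[oB _] := bB.
transitivity (\esum_(f in @hilbert_basis R H) \esum_(e in B)
    (sqc (inner f e) * qform T e)%:E).
  by apply: eq_esum => f _; rewrite -(qform_eigenbasis lT pT bB eigB T1).
rewrite esum_exchange; last first.
  by move=> f e _ _; rewrite lee_fin mulr_ge0 ?sqc_ge0 ?qform_ge0.
apply: eq_esum => e Be.
transitivity (sqn ((Num.sqrt (qform T e))%:C *: e))%:E; last first.
  by rewrite sqnZ sqc_real sqr_sqrtr ?qform_ge0// /sqn oB.1// mulr1.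
rewrite -(parseval _ (hilbert_basisP H)); apply: eq_esum => f _.
rewrite innerZl sqcM sqc_real sqr_sqrtr ?qform_ge0// mulrC.
by rewrite sqc_inner.
Qed.

Lemma sum_gt_card (R : realType) (T : eqType) (s : seq T) (g : T -> R) (a : R) :
  s != [::] -> (forall e, e \in s -> a < g e) ->
  a * (size s)%:R < \sum_(e <- s) g e.
Proof.
elim: s => // e [|f s] IHs _ h; first by rewrite big_seq1 mulr1 h ?mem_head.
rewrite big_cons [size _]/= -natr1 mulrDr mulr1 addrC ltrD//.
  by rewrite h ?mem_head.
by apply: IHs => // x xs; apply: h; rewrite inE xs orbT.
Qed.

Lemma sum_ge_card (R : realType) (T : eqType) (s : seq T) (g : T -> R) (a : R) :
  (forall e, e \in s -> a <= g e) -> a * (size s)%:R <= \sum_(e <- s) g e.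
Proof.
elim: s => [|e s IHs] h; first by rewrite big_nil mulr0.
rewrite big_cons [size _]/= -natr1 mulrDr mulr1 addrC lerD//.
  by rewrite h ?mem_head.
by apply: IHs => // x xs; apply: h; rewrite inE xs orbT.
Qed.

(** A Chebyshev bound: at most M / a elements have [g] above [a]. *)
Lemma finsub_exhaust (R : realType) (T : choiceType) (B : set T) (g : T -> R) (a M : R) :
  0 < a -> (forall s, finsub B s -> \sum_(e <- s) g e <= M) ->
  exists s, uniq s /\ forall e, e \in s <-> B e /\ a < g e.
Proof.
move=> a0 gM; pose C := [set e | B e /\ a < g e].
suff /finite_seqP[s Cs] : finite_set C.
  exists (undup s); split; first exact: undup_uniq.
  move=> e; have Ce : C e = [set` s] e by rewrite Cs.
  rewrite mem_undup; split=> [es|Bge]; first by have : C e by rewrite Ce.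
  by have : [set` s] e by rewrite -Ce.
apply: contrapT => infC.
have [X XC nX] := infinite_set_fset (Num.truncn (M / a)).+1 infC.
have fX : finsub B X by split; [exact: fset_uniq|move=> e /XC[]].
have : a * (size X)%:R <= M.
  by apply: le_trans (gM _ fX); apply: sum_ge_card => e /XC[_ /ltW].
apply/negP; rewrite -ltNge mulrC -ltr_pdivrMr//.
by apply: lt_le_trans (truncnS_gt _) _; rewrite ler_nat.
Qed.

(** The subtraction of 1 in [kappa] reflects the strict inequality; its maximum with 0 covers
    [n = 0], when nothing is known of [x]. *)
Lemma le_kappa (R : realType) (n : nat) (x : R) :
  (n != 0%N -> n%:R < x) -> n%:Z <= kappa x.
Proof.
rewrite /kappa le_max; case: n => // n /(_ isT) h; apply/orP; right.
by rewrite lerBrDr lezD1 ceil_gt_int.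
Qed.

Section Contraction.
Variables (R : realType) (H : hilbert R) (S : H -> H).
Hypotheses (lS : linear S) (sepH : separable H) (tcS : pos_tc_contraction S).

Let pS : positive_op S. Proof. by case: tcS. Qed.

Lemma contraction_le1 x : qform S x <= sqn x.
Proof.
have [_ cS _] := tcS; have := cS x; rewrite !sqn_norm lecR ler_sqrt ?sqn_ge0// => h.
have := cauchy_schwarz (S x) x; rewrite (qformE pS) sqc_real => h2.
rewrite -(@ler_pXn2r _ 2) ?nnegrE ?qform_ge0 ?sqn_ge0//.
by apply: le_trans h2 _; rewrite expr2 ler_wpM2r ?sqn_ge0.
Qed.

Let S1 := contraction_le1.

Lemma qform_defect x : qform (S \- (S \o S)) x = qform S x - sqn (S x).
Proof.
rewrite /qform /= innerBl (positive_selfadjoint lS pS (S x)) /sqn.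
by rewrite raddfB.
Qed.

Lemma defect_linear : linear (S \- (S \o S)).
Proof.
move=> a u v /=; rewrite !(linD lS, linZ lS) scalerBr opprD.
by rewrite addrACA.
Qed.

Lemma defect_positive : positive_op (S \- (S \o S)).
Proof.
move=> x; rewrite /= innerBl (positive_selfadjoint lS pS (S x)) (qformE pS) sqnE.
by rewrite -rmorphB ler0c subr_ge0 contraction_qform.
Qed.

Section Eigenbasis.
Variable B : set H.
Hypotheses (bB : orthonormal_basis B).
Hypothesis eigB : forall e, B e -> S e = (qform S e)%:C *: e.

Let oB : orthonormal_set B. Proof. by case/orthonormal_basisP: bB. Qed.

Lemma eigenvalue_itv e : B e -> 0 <= qform S e <= 1.
Proof.
by move=> Be; rewrite qform_ge0//= (le_trans (S1 e))// /sqn oB.1.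
Qed.

Lemma defect_eigenvalue e : B e ->
  qform (S \- (S \o S)) e = qform S e * (1 - qform S e).
Proof.
move=> Be; rewrite qform_defect eigB// sqnZ sqc_real /sqn oB.1//=; ring.
Qed.

Lemma trace_sum : \esum_(e in B) (qform S e)%:E = (trace_val S)%:E.
Proof.
have [_ _ trS] := tcS.
by rewrite -(trace_eigenbasis lS pS S1 bB eigB) trace_fin.
Qed.

Lemma defect_sum :
  \esum_(e in B) (qform S e * (1 - qform S e))%:E = (defect S)%:E.
Proof.
have trD : trace (S \- (S \o S)) = \esum_(e in B) (qform S e * (1 - qform S e))%:E.
  rewrite (trace_eigenbasis defect_linear defect_positive _ bB).
  - by apply: eq_esum => e Be; rewrite defect_eigenvalue.
  - move=> x; rewrite qform_defect (le_trans _ (S1 x))// lerBlDr lerDl.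
    exact: sqn_ge0.
  - move=> e Be; rewrite defect_eigenvalue//= {1 2}eigB// (linZ lS) {1}eigB//.
    rewrite scalerA -scalerBl -rmorphM -rmorphB; congr (_%:C *: _); ring.
rewrite /defect trD -esum_nneg_fine// => [e Be|].
  by have /andP[h0 h1] := eigenvalue_itv Be; rewrite mulr_ge0// subr_ge0.
apply: (@le_lt_trans _ _ (\esum_(e in B) (qform S e)%:E)); last first.
  by rewrite trace_sum ltry.
apply: le_esum => e Be; rewrite lee_fin.
by have /andP[h0 h1] := eigenvalue_itv Be; nra.
Qed.

Lemma spectral_rank_count (A : set R) s : measurable (A : set (measurableTypeR R)) ->
  uniq s -> (forall e, e \in s <-> B e /\ A (qform S e)) ->
  spectral_rank S A = (size s)%:R%:E.
Proof.
move=> mA us sP.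
have hE : is_spectral_measure S (spectral_measure S).
  have [E hE] := spectral_measure_exists lS pS sepH bB eigB S1.
  by apply: (@getPex _ (is_spectral_measure S)); exists E.
apply: (rank_coordinate_projection bB) => [|x e Be].
  by split=> // e /sP[].
rewrite (spectral_selfadjoint hE)//.
rewrite (spectral_eigenvector lS pS hE mA (eigB Be)) innerZr [(_%:C)^*%C]conjc_real.
rewrite indicE; case: ifPn => es.
  by rewrite mem_set ?mul1r//; have /sP[] := es.
rewrite memNset ?mul0r// => Ae; move/negP: es; apply.
by apply/sP.
Qed.

Variable eps : R.
Hypotheses (eps0 : 0 < eps) (eps2 : eps < 1 / 2).

Lemma large_eigenvalues : exists s,
  [/\ uniq s, (forall e, e \in s <-> B e /\ eps < qform S e),
    Qrank eps S = (size s)%:R%:E,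
    Hrank eps S = (size [seq e <- s | 1 - eps <= qform S e])%:R%:E &
    Lambda eps S = (size [seq e <- s | qform S e < 1 - eps])%:R%:E].
Proof.
have trB s : finsub B s -> \sum_(e <- s) qform S e <= trace_val S.
  by move=> fs; rewrite -lee_fin -trace_sum; exact: esum_ge_finsub.
have [s [us sP]] := finsub_exhaust eps0 trB.
exists s; split=> //; rewrite /Qrank /Hrank /Lambda.
- apply: spectral_rank_count => //.
  by move=> e; rewrite /= in_itv /= andbT.
- apply: spectral_rank_count; [exact: measurable_itv|exact: filter_uniq|].
  move=> e; rewrite mem_filter /= in_itv /=; split.
    by move=> /andP[-> /sP[Be _]]; have /andP[_ ->] := eigenvalue_itv Be.
  move=> [Be /andP[he _]]; rewrite he; apply/sP; split=> //.
  by apply: lt_le_trans he; move: eps2; lra.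
- apply: spectral_rank_count; [exact: measurable_itv|exact: filter_uniq|].
  move=> e; rewrite mem_filter /= in_itv /=; split.
    by move=> /andP[-> /sP[Be ->]].
  by move=> [Be /andP[h1 h2]]; rewrite h2; apply/sP.
Qed.

(* On a spectrum contained in [[0, 1]], the function [t - t * (1 - t) / eps] is
   at most the indicator of [[1 - eps, 1]]; the left-hand sum records the gap. *)
Lemma trace_defect_gap s u : uniq s -> finsub B u ->
  (forall e, e \in s <-> B e /\ 1 - eps <= qform S e) ->
  \sum_(e <- u) (qform S e * (1 - qform S e) + eps * (e \in s)%:R - eps * qform S e)
    + eps * trace_val S <= defect S + eps * (size s)%:R.
Proof.
move=> us fu sP; apply/ler_addgt0Pr => d d0.
(* The trace may be an infinite sum: a finite set reaches it up to d / eps, and [d] is arbitrary. *)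
have [t ft tm] := esum_finsub_approx (divr_gt0 d0 eps0) trace_sum.
pose w := undup (u ++ t); have fw : finsub B w by exact: finsub_undup_cat.
(* With t the eigenvalue of [e], this is (1 - t)(t + eps) on [s] and t(1 - eps - t) off it. *)
pose gap e := qform S e * (1 - qform S e) + eps * (e \in s)%:R - eps * qform S e.
have gap0 e : B e -> 0 <= gap e.
  move=> Be; have /andP[q0 q1] := eigenvalue_itv Be; rewrite /gap.
  have h1 : 0 <= qform S e * (1 - qform S e) by rewrite mulr_ge0// subr_ge0.
  case: (boolP (e \in s)) => es.
    have h2 : 0 <= eps * (1 - qform S e) by rewrite mulr_ge0 ?subr_ge0// ltW.
    by rewrite mulr1; lra.
  have h2 : 0 <= qform S e * (1 - eps - qform S e).
    rewrite mulr_ge0// subr_ge0 ltW// ltNge; apply/negP => h.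
    by move/negP: es; apply; apply/sP.
  by rewrite mulr0 addr0; lra.
have uw : \sum_(e <- u) gap e <= \sum_(e <- w) gap e.
  apply: ler_sum_sub; first by case: fu.
    by move=> e eu; rewrite mem_undup mem_cat eu.
  by move=> e ew; apply: gap0; case: fw => _; exact.
have tw : \sum_(e <- t) qform S e <= \sum_(e <- w) qform S e.
  apply: ler_sum_sub; first by case: ft.
    by move=> e et; rewrite mem_undup mem_cat et orbT.
  by move=> e _; exact: qform_ge0.
have Dw : \sum_(e <- w) qform S e * (1 - qform S e) <= defect S.
  by rewrite -lee_fin -defect_sum; exact: esum_ge_finsub fw.
have sw : \sum_(e <- w) (e \in s)%:R <= (size s)%:R :> R.
  rewrite -natr_sum ler_nat -big_mkcond/= sum1_count -size_filter.
  apply: uniq_leq_size; first by rewrite filter_uniq//; case: fw.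
  by move=> e; rewrite mem_filter => /andP[].
have md : eps * (trace_val S - d / eps) = eps * trace_val S - d.
  by rewrite mulrBr mulrCA divff ?mulr1// gt_eqF.
have := ler_wpM2l (ltW eps0) tw; have := ler_wpM2l (ltW eps0) (ltW tm).
have := ler_wpM2l (ltW eps0) sw.
move: uw; rewrite /gap !sumrB !big_split /= -!mulr_sumr md.
by move: Dw => *; lra.
Qed.

End Eigenbasis.
End Contraction.

(** * Factorizations through a Hilbert-Schmidt operator *)

Lemma hs_norm_sum (R : realType) (H G : hilbert R) (T : H -> G) :
  (\esum_(e in @hilbert_basis R H) (sqn (T e))%:E < +oo)%E ->
  \esum_(e in @hilbert_basis R H) (sqn (T e))%:E = (fine (hs_norm T) ^+ 2)%:E.
Proof.
move=> Tfin; rewrite /hs_norm; under [in RHS]eq_esum do rewrite Re_norm.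
rewrite [LHS]esum_nneg_fine//; last by move=> e _; exact: sqn_ge0.
rewrite [X in sqrte X]esum_nneg_fine//; last by move=> e _; exact: sqn_ge0.
rewrite /= sqr_sqrtr// fine_ge0//; apply: esum_ge0 => e _.
by rewrite lee_fin sqn_ge0.
Qed.

Lemma hilbert_schmidt_sum (R : realType) (H G : hilbert R) (T : H -> G) :
  hilbert_schmidt T -> (\esum_(e in @hilbert_basis R H) (sqn (T e))%:E < +oo)%E.
Proof.
have -> : \esum_(e in @hilbert_basis R H) (sqn (T e))%:E =
    \esum_(e in @hilbert_basis R H) (complex.Re `|T e| ^+ 2)%:E.
  by apply: eq_esum => e _; rewrite Re_norm.
move=> [_ _]; rewrite /hs_norm.
by case: (\esum_(_ in _) _) => [r _| |_]; rewrite ?ltry ?ltNyr.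
Qed.

(** A gap that is uniform on the list survives averaging with weights, some of which may vanish. *)
Lemma exists_lower_gap (R : realType) (T : eqType) (s : seq T) (g : T -> R) (a : R) :
  (forall e, e \in s -> a < g e) -> exists2 b, a < b & forall e, e \in s -> b <= g e.
Proof.
elim: s => [|e s IHs] h; first by exists (a + 1) => //; rewrite ltrDl.
have [x xs|b ab bs] := IHs; first by apply: h; rewrite inE xs orbT.
exists (Num.min b (g e)); first by rewrite lt_min ab h ?mem_head.
by move=> x; rewrite inE ge_min => /predU1P[->|/bs->//]; rewrite lexx orbT.
Qed.

Section EigenspanForms.
Variables (R : realType) (H : hilbert R) (T : H -> H) (B : set H) (s : seq H).
Hypotheses (lT : linear T) (pT : positive_op T) (oB : orthonormal_set B).
Hypotheses (fs : finsub B s).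
Hypothesis eigT : forall e, B e -> T e = (qform T e)%:C *: e.

Lemma qform_eigenspan v : v = lincomb s (inner v) ->
  qform T v = \sum_(e <- s) sqc (inner v e) * qform T e.
Proof.
move=> vs; apply: (@complexI R); rewrite -(qformE pT) {2}vs inner_lincomb_sum.
rewrite rmorph_sum; apply: eq_big_seq => e es /=.
have Be : B e by case: fs => _; exact.
rewrite (positive_selfadjoint lT pT) eigT// innerZr [(_%:C)^*%C]conjc_real.
by rewrite rmorphM /= sqcE; ring.
Qed.

Lemma qform_eigenspan_gt (a : R) v : v = lincomb s (inner v) -> sqn v = 1 ->
  (forall e, e \in s -> a < qform T e) -> a < qform T v.
Proof.
move=> vs v1 /exists_lower_gap[b ab bs]; apply: lt_le_trans ab _.
rewrite (qform_eigenspan vs) -[b]mulr1 -v1 vs (sqn_lincomb _ oB fs) -vs mulr_sumr.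
rewrite !big_seq; apply: ler_sum => e es.
by rewrite mulrC ler_wpM2l ?sqc_ge0// bs.
Qed.

End EigenspanForms.

Section Factorization.
Variables (R : realType) (H G : hilbert R) (S : H -> H) (K : H -> G).
Hypotheses (lS : linear S) (tcS : pos_tc_contraction S).
Hypotheses (lK : linear K) (cK : continuous K).
Hypothesis SE : forall x, S x = adjoint K (K x).

Let pS : positive_op S. Proof. by case: tcS. Qed.
Let bK : bounded_op K. Proof. exact: continuous_bounded_op. Qed.
Let KK' := adjointP lK bK.
Let lK' : linear (adjoint K). Proof. exact: adjoint_linear KK'. Qed.
Let A : G -> G := K \o adjoint K.
Let W := sqrt_op (idfun \- A).

Lemma sqn_factor x : sqn (K x) = qform S x.
Proof. by rewrite /sqn KK' -SE /qform (positive_selfadjoint lS pS). Qed.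

Let lA : linear A. Proof. by move=> a u v; rewrite /A /= lK' lK. Qed.

Let inner_A y z : inner (A y) z = inner (adjoint K y) (adjoint K z).
Proof. exact: KK'. Qed.

Let pA : positive_op A.
Proof. by move=> y; rewrite inner_A; exact: dnorm_ge0. Qed.

Let qA y : qform A y = sqn (adjoint K y).
Proof. by rewrite /qform inner_A. Qed.

(** Passes from K^* K to K K^* : |A y|^2 is the form of [S] at [adjoint K y], hence at most its
    squared norm, which is the form of [A] at [y]; Cauchy-Schwarz concludes. *)
Let A1 y : qform A y <= sqn y.
Proof.
have := cauchy_schwarz (A y) y; rewrite (qformE pA) sqc_real qA.
have := contraction_le1 tcS (adjoint K y).
rewrite -sqn_factor -[K (adjoint K y)]/(A y) => h1 h2.
have [->|q0] := eqVneq (sqn (adjoint K y)) 0; first exact: sqn_ge0.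
have {q0}q0 : 0 < sqn (adjoint K y) by rewrite lt_neqAle eq_sym q0 sqn_ge0.
rewrite -(ler_pM2l q0) -expr2; apply: le_trans h2 _.
by rewrite ler_wpM2r ?sqn_ge0.
Qed.

(** K K^* inherits a finite trace from [S] by [hs_swap], so it too has an eigenbasis, in which the
    square root of I - K K^* is diagonal. *)
Lemma sqrt_op_spec : [/\ linear W, continuous W, positive_op W &
  forall y, W (W y) = y - A y].
Proof.
have trA : (trace A < +oo)%E.
  have [_ _] := tcS; apply: le_lt_trans.
  have -> : trace A = \esum_(g in @hilbert_basis R G) (sqn (adjoint K g))%:E.
    by apply: eq_esum => g _; rewrite -qA.
  rewrite -(hs_swap KK' (hilbert_basisP H) (hilbert_basisP G)).
  by apply: le_esum => e _; rewrite sqn_factor.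
have [U bU eigU] := eigenbasis lA pA trA.
have /orthonormal_basisP[oU tU] := bU.
have A01 u : U u -> 0 <= 1 - qform A u <= 1.
  move=> Uu; have := A1 u; have := qform_ge0 pA u.
  by rewrite [sqn u]/sqn oU.1//= => *; apply/andP; split; lra.
pose w u := Num.sqrt (1 - qform A u).
have w1 u : U u -> w u ^+ 2 <= 1.
  by move=> Uu; have /andP[h0 h1] := A01 u Uu; rewrite sqr_sqrtr.
have WE := coord_opP bU ler01 w1.
have lW := coord_op_linear bU ler01 w1.
apply: (@getPex _ [set W : G -> G | [/\ linear W, continuous W, positive_op W &
  forall y, W (W y) = (idfun \- A) y]]).
exists (coord_op U w); split=> //.
- apply: bounded_op_continuous => //; exists 1 => // x.
  exact: (coord_op_sqn bU ler01 w1).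
- by apply: (coord_op_positive bU ler01 w1) => u _; exact: sqrtr_ge0.
move=> y; apply: (total_eq tU) => u Uu; rewrite !WE// mulrA -rmorphM -expr2 /=.
have /andP[h0 h1] := A01 u Uu.
rewrite sqr_sqrtr// innerBl (inner_eigenbasis lA pA eigU)// rmorphB /=.
by rewrite mulrBl mul1r.
Qed.

Lemma sqn_sqrt_op y : sqn (W y) = sqn y - sqn (adjoint K y).
Proof.
have [lW _ pW WW] := sqrt_op_spec.
by rewrite /sqn -(positive_selfadjoint lW pW) WW innerBl raddfB /= inner_A.
Qed.

Lemma sqn_sqrt_op_factor x : sqn (W (K x)) = qform (S \- (S \o S)) x.
Proof. by rewrite sqn_sqrt_op sqn_factor -SE (qform_defect lS tcS). Qed.

Section Approximant.
Variables (KN : H -> G) (N : nat) (B : set H) (eps : R) (s : seq H).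
Hypotheses (lKN : linear KN) (rKN : (rank KN <= N%:R%:E)%E).
Hypothesis hsK : hilbert_schmidt (K \- KN).
Hypotheses (bB : orthonormal_basis B) (fs : finsub B s).
Hypothesis eigB : forall e, B e -> S e = (qform S e)%:C *: e.

Let T := K \- KN.
Let lT : linear T. Proof. by case: hsK. Qed.
Let bT : bounded_op T. Proof. by case: hsK => *; exact: continuous_bounded_op. Qed.

(** The core of both bounds, used with [V] equal to [K \- KN] and to [W \o (K \- KN)]. The strict
    bound at each kernel vector is what yields [kappa]. *)
Lemma approximant_count_le (V : H -> G) (a : R) : 0 < a ->
  linear V -> bounded_op V ->
  (\esum_(e in @hilbert_basis R H) (sqn (V e))%:E < +oo)%E ->
  (forall v, KN v = 0 -> v = lincomb s (inner v) -> sqn v = 1 -> a < sqn (V v)) ->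
  (size s)%:Z <= N%:Z + kappa (fine (hs_norm V) ^+ 2 / a).
Proof.
move=> a0 lV bV Vfin Va; have /orthonormal_basisP[oB _] := bB.
have [t [D [oD ft st tP]]] := kernel_orthonormal lKN oB fs rKN.
have : (size t)%:Z <= kappa (fine (hs_norm V) ^+ 2 / a).
  apply: le_kappa => t0; rewrite ltr_pdivlMr// mulrC.
  have tn : t != [::] by rewrite -size_eq0.
  apply: (@lt_le_trans _ _ (\sum_(v <- t) sqn (V v))).
    apply: sum_gt_card => // v vt; have [KNv vs] := tP v vt.
    apply: Va => //; have Dv : D v by case: ft => _; exact.
    by rewrite /sqn oD.1.
  rewrite -lee_fin -hs_norm_sum//.
  exact: (hs_orthonormal_le (adjointP lV bV) (hilbert_basisP H) (hilbert_basisP G) oD ft).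
have : (size s)%:Z <= N%:Z + (size t)%:Z by rewrite -PoszD lez_nat.
by move=> h1 h2; apply: le_trans h1 _; rewrite lerD2l.
Qed.

Lemma approximant_count : 0 < eps -> (forall e, e \in s -> eps < qform S e) ->
  (size s)%:Z <= N%:Z + kappa (fine (hs_norm (K \- KN)) ^+ 2 / eps).
Proof.
move=> eps0 seps; have /orthonormal_basisP[oB _] := bB.
apply: approximant_count_le => //; first exact: hilbert_schmidt_sum.
move=> v KNv vs v1; rewrite /T /= KNv subr0 sqn_factor.
exact: (qform_eigenspan_gt lS pS oB fs eigB).
Qed.

Lemma approximant_defect_count : 0 < eps -> eps < 1 ->
  (forall e, e \in s -> eps * (1 - eps) < qform S e * (1 - qform S e)) ->
  (size s)%:Z <=
    N%:Z + kappa (fine (hs_norm (W \o (K \- KN))) ^+ 2 / (eps * (1 - eps))).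
Proof.
move=> eps0 eps1 seps; have /orthonormal_basisP[oB _] := bB.
have [lW _ _ _] := sqrt_op_spec.
have W1 y : sqn (W y) <= sqn y by rewrite sqn_sqrt_op lerBlDr lerDl sqn_ge0.
apply: approximant_count_le.
- by rewrite mulr_gt0// subr_gt0.
- by move=> a u v; rewrite -[LHS]/(W (T (a *: u + v))) lT lW.
- have [C C0 CT] := bT; exists C => // x; exact: le_trans (W1 _) (CT x).
- apply: le_lt_trans (hilbert_schmidt_sum hsK).
  by apply: le_esum => e _; rewrite lee_fin; exact: W1.
move=> v KNv vs v1; rewrite /= KNv subr0 sqn_sqrt_op_factor.
apply: (qform_eigenspan_gt (defect_linear lS) (defect_positive lS tcS) oB fs _ vs v1).
  move=> e Be; rewrite (defect_eigenvalue lS tcS bB eigB Be).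
  rewrite /= {1 2}eigB// (linZ lS) {1}eigB//.
  by rewrite scalerA -scalerBl -rmorphM -rmorphB; congr (_%:C *: _); ring.
move=> e es; rewrite (defect_eigenvalue lS tcS bB eigB) ?seps//.
by case: fs => _; exact.
Qed.

End Approximant.
End Factorization.

(** * The zero Hilbert space *)

(** Carrier of the counterexample S = 0. The alias takes over the module structure of row vectors;
    norm and inner product are built on it. *)
Definition zero_space (R : realType) := 'rV[R[i]]_0.

Section ZeroSpace.
Variable R : realType.

HB.instance Definition _ := GRing.Lmodule.on (zero_space R).

Lemma zero_space_eq (x y : zero_space R) : x = y.
Proof. by rewrite [x]thinmx0 [y]thinmx0. Qed.

Let zero_norm (x : zero_space R) : R[i] := 0.

Let zero_normD (x y : zero_space R) : zero_norm (x + y) <= zero_norm x + zero_norm y.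
Proof. by rewrite addr0. Qed.

Let zero_normZ (a : R[i]) (x : zero_space R) : zero_norm (a *: x) = `|a| * zero_norm x.
Proof. by rewrite mulr0. Qed.

Let zero_norm_eq0 (x : zero_space R) : zero_norm x = 0 -> x = 0.
Proof. by move=> _; exact: zero_space_eq. Qed.

HB.instance Definition _ :=
  Lmodule_isNormed.Build R[i] (zero_space R) zero_normD zero_normZ zero_norm_eq0.

Let zero_complete (F : set_system (zero_space R)) : ProperFilter F -> cauchy F -> cvg F.
Proof.
move=> FF _; apply/cvg_ex; exists 0 => A /nbhs_singleton A0.
by apply: filterS filterT => x _; rewrite (zero_space_eq x 0).
Qed.

HB.instance Definition _ := Uniform_isComplete.Build (zero_space R) zero_complete.

Definition zero_inner (x y : zero_space R) : R[i] := 0.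

Let zero_bilinear : bilinear_for
  (GRing.Scale.Law.clone _ _ ( *%R) _)
  (GRing.Scale.Law.clone _ _ (Num.conj \; *%R) _) zero_inner.
Proof. by split=> [u a x y|u a x y]; rewrite /zero_inner /= mulr0 addr0. Qed.

HB.instance Definition _ :=
  bilinear_isBilinear.Build _ _ _ _ _ _ zero_inner zero_bilinear.

Let zero_hermitian (x y : zero_space R) :
  zero_inner x y = (-1) ^+ false * Num.conj (zero_inner y x).
Proof. by rewrite /zero_inner rmorph0 mulr0. Qed.

HB.instance Definition _ := isHermitianSesquilinear.Build _ _ false Num.conj
  zero_inner zero_hermitian.

Let zero_dot (x : zero_space R) : x != 0 -> 0 < zero_inner x x.
Proof. by rewrite (zero_space_eq x 0) eqxx. Qed.

HB.instance Definition _ := isDotProduct.Build _ _ zero_inner zero_dot.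

Let zero_inner_norm (x : zero_space R) : zero_inner x x = `|x| ^+ 2.
Proof. by rewrite (zero_space_eq x 0) normr0 expr0n. Qed.

Definition zero_hilbert : hilbert R :=
  @Hilbert R (zero_space R) zero_inner zero_inner_norm.

Lemma zero_hilbert_eq (x y : zero_hilbert) : x = y.
Proof. exact: zero_space_eq. Qed.

Lemma zero_hilbert_separable : separable zero_hilbert.
Proof.
exists setT; split; last first.
  by move=> O [x Ox] _; exists x.
apply: sub_countable (countable1 (0 : zero_hilbert)).
by apply: subset_card_le => x _; exact: zero_hilbert_eq.
Qed.

Lemma zero_trace (T : zero_hilbert -> zero_hilbert) : trace T = 0%E.
Proof.
by apply: esum1 => e _; rewrite (zero_hilbert_eq (T e) 0) inner0l.
Qed.

Lemma zero_rank (T : zero_hilbert -> zero_hilbert) : rank T = 0%E.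
Proof.
apply/eqP; rewrite eq_le; apply/andP; split; last first.
  by apply: (@rank_ge _ _ _ T 0%N (fun=> 0)) => c _ [].
apply: ge_ereal_sup => _ [n [x xind] <-]; rewrite lee_fin lern0.
case: n x xind => // n x /(_ (fun=> 1)) h.
by have /eqP := h (zero_hilbert_eq _ _) ord0; rewrite oner_eq0.
Qed.

End ZeroSpace.

(** * The counting inequalities *)

Section Counting.
Variables (R : realType) (H : hilbert R) (S : H -> H) (eps : R).
Hypotheses (lS : linear S) (sepH : separable H) (tcS : pos_tc_contraction S).
Hypotheses (eps0 : 0 < eps) (eps2 : eps < 1 / 2).

(** Gathers the facts about the spectrum: [low] lists the eigenvectors counted by [Lambda], and [h]
    is the number counted by [Hrank]. Afterwards only the approximants and integer arithmetic
    remain. *)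
Lemma eigenvalue_counts : exists B s, let low := [seq e <- s | qform S e < 1 - eps] in
  exists h : nat,
  [/\ orthonormal_basis B /\ (forall e, B e -> S e = (qform S e)%:C *: e),
    finsub B s /\ (forall e, e \in s -> eps < qform S e),
    [/\ Qrank eps S = (size s)%:R%:E, Hrank eps S = h%:R%:E,
        Lambda eps S = (size low)%:R%:E & size s = (size low + h)%N],
    (forall e, e \in low -> eps * (1 - eps) < qform S e * (1 - qform S e)) &
    trace_val S - defect S / eps <= h%:R /\
    (low != [::] -> trace_val S - defect S / eps < h%:R)].
Proof.
have [pS _ trS] := tcS.
have [B bB eigB] := eigenbasis lS pS trS.
have [s [us sP Qs Hs Ls]] := large_eigenvalues lS sepH tcS bB eigB eps0 eps2.
pose high := [seq e <- s | 1 - eps <= qform S e].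
exists B, s; move=> low; exists (size high).
have fs : finsub B s by split=> // e /sP[].
have lowP e : e \in low -> [/\ B e, eps < qform S e & qform S e < 1 - eps].
  by rewrite mem_filter => /andP[h /sP[]].
have uh : uniq high by rewrite filter_uniq.
have highP e : e \in high <-> B e /\ 1 - eps <= qform S e.
  rewrite mem_filter; split=> [/andP[h /sP[]]//|[Be h]].
  by rewrite h; apply/sP; split=> //; apply: lt_le_trans h; move: eps2; lra.
have gap u := trace_defect_gap lS tcS bB eigB eps0 (u := u) uh ^~ highP.
split=> //.
- by split=> // e /sP[].
- split=> //; rewrite !size_filter -(count_predC (fun e => qform S e < 1 - eps)).
  by congr (_ + _)%N; apply: eq_count => e /=; rewrite -leNgt.
- move=> e /lowP[_ h1 h2].
  (* With t the eigenvalue, this product expands to t(1 - t) - eps(1 - eps). *)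
  have : 0 < (qform S e - eps) * (1 - eps - qform S e) by rewrite mulr_gt0 ?subr_gt0.
  by move: (qform S e) => x; nra.
have divE x : (trace_val S - defect S / eps <= x) =
    (eps * trace_val S <= defect S + eps * x).
  by rewrite -(ler_pM2l eps0) mulrBr mulrCA divff ?gt_eqF// mulr1 lerBlDl.
(* The empty family gives the weak bound; below, one vector [e0] of [low] contributes the positive
   gap t(1 - eps - t) and makes it strict. *)
split; first by have := gap [::]; rewrite divE big_nil add0r; apply; split.
case lowE : low => [//|e0 t] _; have e0l : e0 \in low by rewrite lowE mem_head.
have [Be0 h1 h2] := lowP _ e0l.
have e0h : (e0 \in high) = false.
  by apply/negbTE; rewrite mem_filter negb_and -ltNge h2.
have fe0 : finsub B [:: e0] by split=> // e; rewrite inE => /eqP->.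
have := gap _ fe0; rewrite big_seq1 e0h mulr0 addr0.
have pos : 0 < qform S e0 * (1 - eps - qform S e0).
  by rewrite mulr_gt0 ?subr_gt0// (lt_trans eps0).
move=> g.
rewrite -(ltr_pM2l eps0) mulrBr mulrCA divff ?gt_eqF// mulr1 ltrBlDl.
by apply: lt_le_trans g; move: pos; move: (qform S e0) => x; lra.
Qed.

End Counting.

Lemma Llow_le (R : realType) (H : hilbert R) (S : H -> H) (eps : R) (h : nat) :
  trace_val S - defect S / eps <= h%:R -> Llow eps S <= h%:Z.
Proof. by move=> le; rewrite /Llow ceil_le_int ge_max le ler0n. Qed.

Lemma Lcirc_le (R : realType) (H : hilbert R) (S : H -> H) (eps : R) (h : nat) :
  trace_val S - defect S / eps < h%:R -> Lcirc eps S <= h%:Z.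
Proof. by move=> lt; rewrite /Lcirc ge_max lez_nat leq0n lezD1 floor_lt_int. Qed.

Lemma Llow_le_Lcirc (R : realType) (H : hilbert R) (S : H -> H) (eps : R) :
  Llow eps S <= Lcirc eps S.
Proof.
rewrite /Llow /Lcirc ceil_le_int ge_max; apply/andP; split; last first.
  by rewrite ler0z le_max lexx.
apply: le_trans (ltW (floorD1_gt _)) _.
by rewrite ler_int le_max lexx orbT.
Qed.

Theorem theorem8p2 (R : realType) :
  (forall (H : hilbert R) (S : {linear H -> H}) (eps : R),
    separable H -> pos_tc_contraction S -> 0 < eps -> eps < 1 / 2 ->
    [/\ ((Llow eps S)%:~R%:E <= Hrank eps S)%E,
        Lambda eps S = (Qrank eps S - Hrank eps S)%E,
        (forall Qbar : int, (Qrank eps S <= Qbar%:~R%:E)%E ->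
          [/\ (Lambda eps S <= (Qbar - Llow eps S)%:~R%:E)%E,
              (Lambda eps S <= (Num.max 0 (Qbar - Lcirc eps S))%:~R%:E)%E &
              Num.max 0 (Qbar - Lcirc eps S) <= Qbar - Llow eps S]),
        (forall (G : hilbert R) (K KN : {linear H -> G}) (N : nat),
          hilbert_schmidt K ->
          (forall x, S x = adjoint K (K x)) ->
          (rank KN <= N%:R%:E)%E ->
          hilbert_schmidt (K \- KN) ->
          let W := sqrt_op (idfun \- (K \o adjoint K)) in
          let e2 := fine (hs_norm (K \- KN)) ^+ 2 in
          let d2 := fine (hs_norm (W \o (K \- KN))) ^+ 2 in
          (Lambda eps S <=
            (Num.min (N%:Z + kappa (d2 / (eps * (1 - eps))))
               (Num.max 0 (N%:Z + kappa (e2 / eps) - Lcirc eps S)))%:~R%:E)%E) &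
        (Lambda eps S <=
          (Num.min (kappa (defect S / (eps * (1 - eps))))
             (Num.max 0 (kappa (trace_val S / eps) - Lcirc eps S)))%:~R%:E)%E
        /\ ((0 < Lambda eps S)%E ->
            ((Lcirc eps S)%:~R%:E <= Hrank eps S)%E)]) /\
  (exists (H : hilbert R) (S : {linear H -> H}) (eps : R),
    [/\ separable H, pos_tc_contraction S, 0 < eps, eps < 1 / 2 &
        (Hrank eps S < (Lcirc eps S)%:~R%:E)%E]).
Proof.
split; last first.
  pose S : {linear zero_hilbert R -> zero_hilbert R} := \0.
  exists (zero_hilbert R), S, (1 / 4); split.
  - exact: zero_hilbert_separable.
  - split; last by rewrite zero_trace ltry.
      by move=> x; rewrite inner0l.
    by move=> x; rewrite normr0.
  - by lra.
  - by lra.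
  (* Here m = D = 0, so [Lcirc] is floor 0 + 1 = 1 while [Hrank] is 0. *)
  rewrite /Hrank /spectral_rank zero_rank /Lcirc /trace_val /defect !zero_trace.
  by rewrite /= mul0r subr0 floor0 add0r lte_fin ltr0z.
move=> H S eps sepH tcS eps0 eps2.
have eps1 : eps < 1 by lra.
have lS : linear S := linearP S.
have [B [s]] := eigenvalue_counts lS sepH tcS eps0 eps2.
set low := [seq e <- s | _] => -[h [[bB eigB] [fs sP] [Qs Hs Ls sE] lowP [gap gap']]].
have fl : finsub B low.
  case: fs => us sB; split; first exact: filter_uniq.
  by move=> e; rewrite mem_filter => /andP[_ /sB].
have natE (n : nat) (z : int) : (n%:R%:E <= z%:~R%:E :> \bar R)%E = (n%:Z <= z).
  by rewrite lee_fin -[n%:R]/(n%:Z%:~R) ler_int.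
have intE (n : nat) (z : int) : (z%:~R%:E <= n%:R%:E :> \bar R)%E = (z <= n%:Z).
  by rewrite lee_fin -[n%:R]/(n%:Z%:~R) ler_int.
have Lh : Llow eps S <= h%:Z := Llow_le gap.
have LL := Llow_le_Lcirc S eps.
have Lch : (0 < size low)%N -> Lcirc eps S <= h%:Z.
  by rewrite lt0n size_eq0 => /gap'; exact: Lcirc_le.
(* An empty [low] is covered by the outer maximum; otherwise [Lcirc] is at most [h] and can be
   subtracted from the bound on the size of [s]. *)
have Lmax z : (size s)%:Z <= z -> (size low)%:Z <= Num.max 0 (z - Lcirc eps S).
  rewrite sE PoszD le_max => sz; case: (posnP (size low)) => [->//|/Lch].
  by move=> Lc; apply/orP; right; rewrite lerBrDr (le_trans _ sz)// lerD2l.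
rewrite Hs Qs Ls; split.
- by rewrite intE.
- by rewrite sE natrD EFinD addeK.
- move=> Qbar; rewrite natE => sQ; rewrite !natE Lmax//; split=> //.
    by move: sQ; rewrite sE PoszD => sQ; rewrite lerBrDr (le_trans _ sQ)// lerD2l.
  rewrite ge_max lerD2l lerN2 LL andbT subr_ge0 (le_trans Lh)// (le_trans _ sQ)//.
  by rewrite sE lez_nat leq_addl.
- move=> G K KN N hsK SE rKN hsT; lazy zeta.
  have lKN : linear KN := linearP KN; have [lK cK _] := hsK.
  rewrite natE le_min; apply/andP; split.
    apply: (approximant_defect_count lS tcS lK cK SE lKN rKN hsT bB fl eigB
      eps0 eps1 lowP).
  by apply: Lmax; exact: (approximant_count lS tcS lK cK SE lKN rKN hsT bB fs eigB
    eps0 sP).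
split; last first.
  by rewrite lte_fin ltr0n intE; exact: Lch.
(* For the zero approximant no factor of [S] is constructed: m and D are themselves sums over the
   eigenbasis, to which each counted eigenvector contributes more than eps, resp. eps(1 - eps). *)
have e1 : 0 < eps * (1 - eps) by rewrite mulr_gt0// subr_gt0.
rewrite natE le_min; apply/andP; split; last first.
  apply: Lmax; apply: le_kappa; rewrite size_eq0 => s0.
  rewrite ltr_pdivlMr// mulrC; apply: (lt_le_trans (sum_gt_card s0 sP)).
  rewrite -lee_fin -(trace_sum lS tcS bB eigB); exact: esum_ge_finsub.
apply: le_kappa; rewrite size_eq0 => l0.
rewrite ltr_pdivlMr// mulrC; apply: (lt_le_trans (sum_gt_card l0 lowP)).
by rewrite -lee_fin -(defect_sum lS tcS bB eigB); exact: esum_ge_finsub.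
Qed.
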